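(* Given a finite set $S$ of $m$ points in $\mathbb{R}^n$, one can construct in $O(n\cdot m^n)$ time a set of $n\cdot m^n$ linear constraints whose set of solutions is exactly $F_{\min}(\mathsf{conv}(S))$.
   Context: $\mathsf{conv}$ denotes convex hull. For a finite nonempty $P\subseteq\mathbb{R}^n$, $f_{\min}(P)$ is the coordinatewise minimum of $P$; for $X\subseteq\mathbb{R}^n$, $F_{\min}(X)=\{f_{\min}(P)\mid P\text{ a finite nonempty subset of } X\}$. *)

(* Defs.v *)
From HB Require Import structures.
From mathcomp Require Import all_boot all_order all_algebra finmap.
From mathcomp Require Import boolp classical_sets reals convex.

Set Implicit Arguments.
Unset Strict Implicit.
Unset Printing Implicit Defensive.

Import Order.TTheory GRing.Theory Num.Theory.

Local Open Scope classical_set_scope.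
Local Open Scope ring_scope.

Definition conv_hull (R : realType) (n : nat) (X : set 'rV[R]_n) :
    set 'rV[R]_n :=
  smallest (@convex_set R 'rV[R]_n) X.

(* Only meaningful for nonempty P: the seed of the iterated minimum is the
   coordinate of some element of P. *)
Definition fmin (R : realType) (n : nat) (P : {fset 'rV[R]_n}) : 'rV[R]_n :=
  \row_j \big[Num.min/(head 0 P) 0 j]_(p <- P) p 0 j.

Definition Fmin (R : realType) (n : nat) (X : set 'rV[R]_n) :
    set 'rV[R]_n :=
  [set fmin P | P in [set P : {fset 'rV[R]_n} | P != fset0 /\ [set` P] `<=` X]].

(* (a, false, b) stands for a . x <= b and (a, true, b) for a . x = b. *)
Notation lincon R n := ('rV[R]_n * bool * R)%type.

Definition satisfies (R : realType) (n : nat) (x : 'rV[R]_n)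
    (c : lincon R n) : bool :=
  let: (a, is_eq, b) := c in
  let ax := \sum_(j < n) a 0 j * x 0 j in
  if is_eq then ax == b else ax <= b.

Definition solutions (R : realType) (n : nat) (K : {fset lincon R n}) :
    set 'rV[R]_n :=
  [set x | forall c, c \in K -> satisfies x c].

(* Real RAM, presented as a structured language.  The memory consists of
   integer arrays (one index) and real arrays (two indices), unbounded and
   indirectly addressable; an array is named by a number fixed in the program.
   A program contains no real constant besides 0 and 1, integers can only be
   added and subtracted (truncated at 0), and there is no rounding from reals
   to integers. *)
Inductive nexp : Type :=
| NConst of nat
| NLoad of nat & nexp
| NAdd of nexp & nexp
| NSub of nexp & nexp.

Inductive rexp : Type :=
| RZero
| ROne
| RLoad of nat & nexp & nexp
| RAdd of rexp & rexp
| RSub of rexp & rexp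
| RMul of rexp & rexp
| RDiv of rexp & rexp.

Inductive bexp : Type :=
| BLeN of nexp & nexp
| BLeR of rexp & rexp
| BNot of bexp
| BAnd of bexp & bexp.

(* The output is a write-only stream of linear constraints in sparse form:
   [Term j c] adds the term c * x_j to the left-hand side under construction;
   [Close is_eq b] completes the constraint with its relation and its
   right-hand side b, and starts a new one. *)
Inductive cmd : Type :=
| Skip
| NStore of nat & nexp & nexp
| RStore of nat & nexp & nexp & rexp
| Term of nexp & rexp
| Close of bool & rexp
| Seq of cmd & cmd
| If of bexp & cmd & cmd
| While of bexp & cmd.

(* Unit-cost model: one time unit per arithmetic operation, comparison, memory
   access or constant. *)
Fixpoint ncost (e : nexp) : nat :=
  match e with
  | NConst _ => 1
  | NLoad _ e1 => (ncost e1).+1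
  | NAdd e1 e2 | NSub e1 e2 => (ncost e1 + ncost e2).+1
  end.

Fixpoint rcost (e : rexp) : nat :=
  match e with
  | RZero | ROne => 1
  | RLoad _ i j => (ncost i + ncost j).+1
  | RAdd e1 e2 | RSub e1 e2 | RMul e1 e2 | RDiv e1 e2 =>
      (rcost e1 + rcost e2).+1
  end.

Fixpoint bcost (b : bexp) : nat :=
  match b with
  | BLeN e1 e2 => (ncost e1 + ncost e2).+1
  | BLeR e1 e2 => (rcost e1 + rcost e2).+1
  | BNot b1 => (bcost b1).+1
  | BAnd b1 b2 => (bcost b1 + bcost b2).+1
  end.

Definition sparse_con (R : realType) : Type := (seq (nat * R) * bool * R)%type.

Record state (R : realType) : Type := State {
  nmem : nat -> nat -> nat;
  rmem : nat -> nat -> nat -> R;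
  pending : seq (nat * R);
  output : seq (sparse_con R) }.

Definition nupd (M : nat -> nat -> nat) (a i v : nat) : nat -> nat -> nat :=
  fun a' i' => if (a' == a) && (i' == i) then v else M a' i'.

Definition rupd (R : realType) (M : nat -> nat -> nat -> R) (a i j : nat)
    (v : R) : nat -> nat -> nat -> R :=
  fun a' i' j' =>
    if [&& a' == a, i' == i & j' == j] then v else M a' i' j'.

Fixpoint neval (R : realType) (st : state R) (e : nexp) : nat :=
  match e with
  | NConst k => k
  | NLoad a e1 => nmem st a (neval st e1)
  | NAdd e1 e2 => (neval st e1 + neval st e2)%N
  | NSub e1 e2 => (neval st e1 - neval st e2)%N
  end.

Fixpoint reval (R : realType) (st : state R) (e : rexp) : R :=
  match e with
  | RZero => 0
  | ROne => 1
  | RLoad a i j => rmem st a (neval st i) (neval st j)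
  | RAdd e1 e2 => reval st e1 + reval st e2
  | RSub e1 e2 => reval st e1 - reval st e2
  | RMul e1 e2 => reval st e1 * reval st e2
  | RDiv e1 e2 => reval st e1 / reval st e2
  end.

Fixpoint beval (R : realType) (st : state R) (b : bexp) : bool :=
  match b with
  | BLeN e1 e2 => (neval st e1 <= neval st e2)%N
  | BLeR e1 e2 => reval st e1 <= reval st e2
  | BNot b1 => ~~ beval st b1
  | BAnd b1 b2 => beval st b1 && beval st b2
  end.

(* [exec p st t st']: started in state st, the program p halts after exactly
   t time units in state st'. *)
Inductive exec (R : realType) : cmd -> state R -> nat -> state R -> Prop :=
| ExecSkip st : exec Skip st 1 st
| ExecNStore st a i e :
    exec (NStore a i e) st (ncost i + ncost e).+1
      (State (nupd (nmem st) a (neval st i) (neval st e))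
             (rmem st) (pending st) (output st))
| ExecRStore st a i j e :
    exec (RStore a i j e) st (ncost i + ncost j + rcost e).+1
      (State (nmem st)
             (rupd (rmem st) a (neval st i) (neval st j) (reval st e))
             (pending st) (output st))
| ExecTerm st j e :
    exec (Term j e) st (ncost j + rcost e).+1
      (State (nmem st) (rmem st)
             ((neval st j, reval st e) :: pending st) (output st))
| ExecClose st is_eq e :
    exec (Close is_eq e) st (rcost e).+1
      (State (nmem st) (rmem st) [::]
             ((pending st, is_eq, reval st e) :: output st))
| ExecSeq p1 p2 st1 st2 st3 t1 t2 :
    exec p1 st1 t1 st2 -> exec p2 st2 t2 st3 ->
    exec (Seq p1 p2) st1 (t1 + t2) st3
| ExecIfTrue b p1 p2 st t st' :
    beval st b -> exec p1 st t st' ->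
    exec (If b p1 p2) st (bcost b + t) st'
| ExecIfFalse b p1 p2 st t st' :
    ~~ beval st b -> exec p2 st t st' ->
    exec (If b p1 p2) st (bcost b + t) st'
| ExecWhileFalse b p st :
    ~~ beval st b -> exec (While b p) st (bcost b) st
| ExecWhileTrue b p st1 st2 st3 t1 t2 :
    beval st1 b -> exec p st1 t1 st2 -> exec (While b p) st2 t2 st3 ->
    exec (While b p) st1 (bcost b + t1 + t2) st3.

(* Integer array 0 holds n and the number of points in cells 0 and 1; cell
   (k, j) of real array 0 holds coordinate j of the k-th point; every other
   cell is 0. *)
Definition init_state (R : realType) (n : nat) (s : seq 'rV[R]_n) : state R :=
  State
    (fun a i => if a == 0%N then nth 0%N [:: n; size s] i else 0%N)
    (fun a k j =>
       if a == 0%N then oapp (fun j' : 'I_n => (nth 0 s k) 0 j') 0 (insub j)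
       else 0)
    [::] [::].

Definition well_indexed (R : realType) (n : nat) (c : sparse_con R) : bool :=
  all (fun t => (t.1 < n)%N) c.1.1.

Definition decode (R : realType) (n : nat) (c : sparse_con R) :
    lincon R n :=
  (\row_(j < n) \sum_(t <- c.1.1 | t.1 == j) t.2, c.1.2, c.2).

(* Every constraint of K is written exactly once, in any order. *)
Definition constructs (R : realType) (n : nat) (p : cmd) (s : seq 'rV[R]_n)
    (t : nat) (K : {fset lincon R n}) : Prop :=
  exists st' : state R,
    [/\ exec p (init_state s) t st',
        all (@well_indexed R n) (output st')
      & perm_eq (map (@decode R n) (output st')) K].

(* Running time and result are determined by the program and the input. *)
Lemma exec_deterministic (R : realType) (p : cmd) (st : state R) (t1 t2 : nat)
    (st1 st2 : state R) :
  exec p st t1 st1 -> exec p st t2 st2 -> t1 = t2 /\ st1 = st2.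
Proof.
move=> E; elim: E t2 st2 => {p st t1 st1}; intros;
  match goal with H : exec _ _ _ _ |- _ => inversion H; subst end => //;
  repeat match goal with
  | IH : forall t2 st2, exec ?p ?st t2 st2 -> _, H : exec ?p ?st _ _ |- _ =>
      have [? ?] := IH _ _ H; clear H; subst
  | H : is_true (~~ ?b), H' : is_true ?b |- _ => by rewrite H' in H
  end => //.
Qed.

(* Main.v *)
Require Import Defs.
From HB Require Import structures.
From mathcomp Require Import all_boot all_order all_algebra finmap.
From mathcomp Require Import boolp classical_sets unstable reals.
From mathcomp Require Import interval_inference convex.
From mathcomp Require Import zify ring.

(* Put x in homogeneous coordinates (-x, 1).  A point x lies in Fmin (conv S)
   iff for every i it is in the projection of the set of p in conv S with p >= x
   and p_i = x_i, that is, iff (-x, 1) is in the cone generated by the (-s, 1),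
   s in S, and the unit vectors e_j, j <> i, j < n.  By Farkas' lemma a point
   outside is cut off by a nonnegative functional on these m + n - 1
   generators, and such a functional can be rotated, keeping its value at x,
   until n linearly independent generators are tight.

   Testing each n-subset of generators against all points would cost a factor
   m too much.  Instead, drop the tight generator of largest index: the n - 1
   others are d_l + l for a nondecreasing sequence d of n - 1 numbers below m,
   and, modulo their span, all generators lie in a plane, where the facets
   through them are found in time linear in m by gift wrapping, at most two of
   them.  Of the m^(n-1) sequences d at most n m^(n-1) / 2^(n-1) are
   nondecreasing, which absorbs the polynomial in n spent on each of them.  The
   at most 2n constraints found for one d are completed to n m by trivial ones
   0 <= q.  When S is a single point the constraints are the n equations
   x_i = s_i. *)

Set Implicit Arguments.
Unset Strict Implicit.
Unset Printing Implicit Defensive.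

Import Order.TTheory GRing.Theory Num.Theory.

Local Open Scope classical_set_scope.
Local Open Scope fset_scope.
Local Open Scope ring_scope.

(** * Separation from finitely generated cones *)

(** Every one of the m^(n-1) sequences d, nondecreasing or not, writes exactly n m constraints, and
    a skipped one costs O(n m); this alone accounts for n m^n in number and in time. Since the
    constraints form a set of exactly that size, no two of them may coincide: positive rescaling is
    free for an inequality, so each one carries its running number as its norm.

    A nondecreasing d costs O(n m (n+1)^3): for each of n coordinates i, n - 1 eliminations in a
    table of m + n + 1 rows and n + 1 columns. There are at most n m^(n-1) / 2^(n-1) of them, so
    what has to be bounded is (n+1)^4 / 2^(n-1).

    A single point is a case apart for two reasons: 2n constraints do not fit into n m places, and
    its generators span only a hyperplane, whereas the rotation to n tight generators needs them to
    span, together with x, the whole space.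

    Soundness and completeness are separated: whatever gift wrapping returns with flag 0 is valid,
    also for linearly dependent d, and only completeness needs d independent. *)

Definition dot (R : realFieldType) (d : nat) (u v : 'rV[R]_d) : R :=
  \sum_j u 0 j * v 0 j.

Section Dot.
Variables (R : realFieldType) (d : nat).
Implicit Types u v w : 'rV[R]_d.

Lemma dotC u v : dot u v = dot v u.
Proof. by apply: eq_bigr => j _; rewrite mulrC. Qed.

Lemma dotDl u v w : dot (u + v) w = dot u w + dot v w.
Proof. by rewrite -big_split; apply: eq_bigr => j _; rewrite mxE mulrDl. Qed.

Lemma dotZl a u w : dot (a *: u) w = a * dot u w.
Proof. by rewrite mulr_sumr; apply: eq_bigr => j _; rewrite mxE mulrA. Qed.

Lemma dotNl u w : dot (- u) w = - dot u w.
Proof. by rewrite -scaleN1r dotZl mulN1r. Qed.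

Lemma dotBl u v w : dot (u - v) w = dot u w - dot v w.
Proof. by rewrite dotDl dotNl. Qed.

Lemma dotZr a u w : dot w (a *: u) = a * dot w u.
Proof. by rewrite dotC dotZl (dotC w). Qed.

Lemma dotBr u v w : dot w (u - v) = dot w u - dot w v.
Proof. by rewrite dotC dotBl !(dotC w). Qed.

Lemma dot_eq0 u : (dot u u == 0) = (u == 0).
Proof.
apply/idP/eqP => [|->]; last by rewrite /dot big1 // => j _; rewrite mxE mul0r.
rewrite psumr_eq0 => [/allP h|j _]; last by rewrite -expr2 sqr_ge0.
apply/rowP => j; rewrite mxE; apply/eqP.
by have := h j (mem_index_enum _); rewrite mulf_eq0 orbb.
Qed.

(** Induction on the number of generators, with the hypothesis used twice: on all generators but the
    first one [v], and, if the functional [a] found there is negative at [v], on their projections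
    along [v] onto the kernel of [a]. *)
Lemma farkas (M : nat) (V : 'I_M -> 'rV[R]_d) (x : 'rV[R]_d) :
  (exists2 lam : 'I_M -> R, forall k, 0 <= lam k & x = \sum_k lam k *: V k) \/
  (exists2 a, forall k, 0 <= dot a (V k) & dot a x < 0).
Proof.
elim: M V x => [|M IH] V x.
  have [->|x0] := eqVneq x 0.
    by left; exists (fun=> 0) => //; rewrite big_ord0.
  right; exists (- x) => [[]//|]; rewrite dotNl oppr_lt0 lt_neqAle eq_sym dot_eq0 x0.
  by apply: sumr_ge0 => j _; rewrite -expr2 sqr_ge0.
have [[lam l0 xE]|[a aV ax]] := IH (V \o lift ord0) x.
  left; exists (fun k => if unlift ord0 k is Some k' then lam k' else 0).
    by move=> k; case: unliftP.
  rewrite big_ord_recl unlift_none scale0r add0r xE.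
  by apply: eq_bigr => k _; rewrite liftK.
set v := V ord0.
have [av|av] := leP 0 (dot a v).
  right; exists a => // k; case: (unliftP ord0 k) => [k' ->|->] //; exact: aV.
pose pr w := w - (dot a w / dot a v) *: v.
have [[lam l0 xE]|[b bV bx]] := IH (fun k => pr (V (lift ord0 k))) (pr x).
  (* The coefficient of [v] undoes the projections. It is nonnegative because [a] is negative at
     both [x] and [v] and nonnegative at the other generators. *)
  left; exists (fun k => if unlift ord0 k is Some k' then lam k' else
     dot a x / dot a v - \sum_k lam k * (dot a (V (lift ord0 k)) / dot a v)).
    move=> k; case: unliftP => // _.
    rewrite subr_ge0 (@le_trans _ _ 0) //; last by rewrite ltW // nmulr_rgt0 // invr_lt0.
    apply: sumr_le0 => l _; rewrite mulr_ge0_le0 // mulr_ge0_le0 ?aV //.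
    by rewrite invr_le0 ltW.
  rewrite big_ord_recl unlift_none scalerBl.
  move: xE; rewrite /pr; move: (dot a x / dot a v) => e /eqP.
  rewrite subr_eq => /eqP ->.
  rewrite -/v [LHS]addrC -addrA; congr (_ + _).
  rewrite scaler_suml -sumrN -big_split.
  by apply: eq_bigr => k _; rewrite liftK scalerBr scalerA /= addrC.
(* This is [b] composed with the projection, so it vanishes at [v]. *)
right; exists (b - (dot b v / dot a v) *: a).
  move=> k; case: (unliftP ord0 k) => [k' ->|->].
    move: (bV k'); rewrite dotBr dotZr dotBl dotZl.
    by congr (_ <= _ - _); ring.
  by rewrite dotBl dotZl divfK ?subrr // lt_eqF.
move: bx; rewrite dotBr dotZr dotBl dotZl.
by congr (_ - _ < _); ring.
Qed.

Lemma ortho_exists (r : nat) (W : 'I_r -> 'rV[R]_d) : (r < d)%N ->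
  exists2 c, c != 0 & forall l, dot c (W l) = 0.
Proof.
move=> rd; pose A := \matrix_(j < d, l < r) W l 0 j.
have kA : kermx A != 0.
  rewrite -mxrank_eq0 mxrank_ker -lt0n subn_gt0.
  by apply: leq_ltn_trans rd; exact: rank_leq_col.
have [i ki] : exists i, row i (kermx A) != 0.
  apply/existsP; apply: contraR kA; rewrite negb_exists => /forallP h.
  by apply/eqP/row_matrixP => i; rewrite row0; apply/eqP; rewrite -[_ == _]negbK.
exists (row i (kermx A)) => // l.
have := congr1 (fun B : 'M_(d, r) => B i l) (mulmx_ker A); rewrite !mxE => <-.
by apply: eq_bigr => j _; rewrite !mxE.
Qed.

(* As long as fewer than d - 1 generators are tight, a can be moved along a
   direction orthogonal to them and to x until one more becomes tight. *)
Lemma extremal_separation (M : nat) (V : 'I_M -> 'rV[R]_d) (x a : 'rV[R]_d) :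
  (forall k, 0 <= dot a (V k)) -> dot a x < 0 ->
  (forall c, (forall k, dot c (V k) = 0) -> dot c x = 0 -> c = 0) ->
  forall r, (r < d)%N ->
  exists (a' : 'rV[R]_d) (K : 'I_r -> 'I_M) (C : 'I_r -> 'rV[R]_d),
    [/\ forall k, 0 <= dot a' (V k), dot a' x < 0,
        forall l, dot a' (V (K l)) = 0 &
        forall l l', dot (C l) (V (K l')) = (l == l')%:R].
Proof.
move=> aV ax span; elim=> [_|r IH rd].
  have K0 T (k : 'I_0) : T by case: k.
  by exists a, (K0 _), (fun=> 0); split => // -[].
have [a' [K [C [a'V a'x a'K CK]]]] := IH (ltnW rd).
have [c0 c0n c0K] : exists2 c, c != 0 & (forall l, dot c (V (K l)) = 0) /\ dot c x = 0.
  have [c cn cW] := @ortho_exists r.+1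
    (fun l => if unlift ord0 l is Some l' then V (K l') else x) rd.
  exists c => //; split => [l|]; last by have := cW ord0; rewrite unlift_none.
  by have := cW (lift ord0 l); rewrite liftK.
have [c [k0 ck0] [cK cx]] : exists2 c, exists k, dot c (V k) < 0 &
    (forall l, dot c (V (K l)) = 0) /\ dot c x = 0.
  (* By [span], a nonzero functional vanishing at [x] cannot vanish at all generators; up to sign it
     is negative at one, so the move is stopped eventually. *)
  have [k0 ck0] : exists k, dot c0 (V k) != 0.
    apply/existsP; apply: contraR c0n; rewrite negb_exists => /forallP h.
    by apply/eqP/span => [k|]; [apply/eqP; rewrite -[_ == _]negbK | case: c0K].
  have [lt0|gt0] := ltP (dot c0 (V k0)) 0; first by exists c0 => //; exists k0.
  exists (- c0); first by exists k0; rewrite dotNl oppr_lt0 lt_neqAle eq_sym ck0.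
  by split => [l|]; rewrite dotNl (c0K.1, c0K.2) oppr0.
(* Ratio test: [q k] is the step length at which generator [k] becomes tight, and the smallest one
   keeps all the others nonnegative. *)
pose q k := dot a' (V k) / - dot c (V k).
case: (@Order.TotalTheory.arg_minP _ R _ k0 (fun k => dot c (V k) < 0) q ck0)
  => k1 ck1 kmin.
have q0 : 0 <= q k1 by rewrite divr_ge0 // oppr_ge0 ltW.
(* The family [C], dual to the tight generators, certifies their independence. [e] is dual to the
   new generator and corrects the older functionals there. *)
pose e := (dot c (V k1))^-1 *: c.
have eK l : dot e (V (K l)) = 0 by rewrite dotZl cK mulr0.
have e1 : dot e (V k1) = 1 by rewrite dotZl mulVf // lt_eqF.
exists (a' + q k1 *: c),
  (fun l => if unlift ord0 l is Some l' then K l' else k1),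
  (fun l => if unlift ord0 l is Some l' then C l' - dot (C l') (V k1) *: e else e).
split.
- move=> k; rewrite dotDl dotZl.
  have [ck|ck] := ltP (dot c (V k)) 0; last by rewrite addr_ge0 // mulr_ge0.
  have := kmin k ck; rewrite [X in _ <= X]/q ler_pdivlMr ?oppr_gt0 //.
  by rewrite mulrN -subr_ge0 opprK.
- by rewrite dotDl dotZl cx mulr0 addr0.
- move=> l; case: unliftP => [l' _|_]; rewrite dotDl dotZl ?a'K ?cK ?mulr0 ?addr0 //.
  by rewrite /q invrN mulrN mulNr mulfVK ?lt_eqF // subrr.
- move=> l l'; case: (unliftP ord0 l) => [j ->|->]; case: (unliftP ord0 l') => [j' ->|->];
    rewrite ?liftK ?unlift_none.
  + by rewrite dotBl dotZl eK mulr0 subr0 CK (inj_eq lift_inj).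
  + by rewrite dotBl dotZl e1 mulr1 subrr -[_ == _]negbK eq_sym neq_lift.
  + by rewrite eK -[_ == _]negbK neq_lift.
  + by rewrite e1 eqxx.
Qed.
End Dot.

(** * Gift wrapping in the plane *)

Section Wrap.
Variable R : realFieldType.
Implicit Types (al be : nat -> R) (ks : seq nat) (c : R * R).

(** [s.1] is the current direction, [s.2] tells whether it was replaced during this pass. The zero
    direction must be excluded: its cross product with every generator is 0, so it would never be
    left. *)
Definition wrap_step al be (s : R * R * nat) (k : nat) : R * R * nat :=
  if ((s.1.1 != 0) || (s.1.2 != 0)) && (0 <= s.1.1 * be k - s.1.2 * al k)
  then s else (al k, be k, 1%N).

Definition wrap_pass al be ks c := foldl (wrap_step al be) (c, 0%N) ks.

(* The first pass may stay on the direction opposite to the extreme one until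
   after the latter has been read; then the second pass reaches it.  The third
   leaves the flag at 0 iff no generator is strictly clockwise of the result. *)
Definition gift_wrap al be ks :=
  wrap_pass al be ks (wrap_pass al be ks (wrap_pass al be ks (0, 0)).1).1.

(** The flag is never lowered within a pass, so a final 0 means that all tests succeeded for one and
    the same direction. This certificate holds for arbitrary generators and is the source of
    soundness. *)
Lemma wrap_flag_valid al be ks c : (wrap_pass al be ks c).2 = 0%N ->
  (wrap_pass al be ks c).1 = c /\ {in ks, forall k, 0 <= c.1 * be k - c.2 * al k}.
Proof.
rewrite /wrap_pass; have F l s : (foldl (wrap_step al be) (s, 1%N) l).2 = 1%N.
  by elim: l s => //= k l IH s; rewrite {2}/wrap_step; case: ifP => _; apply: IH.
elim: ks => //= k ks IH; rewrite {2 4}/wrap_step /=; case: ifP => [/andP[_ h]|_].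
  by case/IH => -> h'; split => // j; rewrite inE => /predU1P[->|/h'].
by rewrite F.
Qed.

Lemma wrap_pass_fixed al be ks c : (c.1 != 0) || (c.2 != 0) ->
  {in ks, forall k, 0 <= c.1 * be k - c.2 * al k} ->
  wrap_pass al be ks c = (c, 0%N).
Proof.
move=> c0; rewrite /wrap_pass; elim: ks => //= k ks IH h.
rewrite {2}/wrap_step /= c0 h ?mem_head //=; apply: IH => j jk.
by apply: h; rewrite inE jk orbT.
Qed.

Lemma foldl_inv (T : Type) (S : eqType) (g : T -> S -> T) (P : T -> Prop)
    (l : seq S) z :
  (forall s k, k \in l -> P s -> P (g s k)) -> P z -> P (foldl g z l).
Proof.
elim: l z => //= k l IH z h Pz; apply: IH => [s j jl|]; last by apply: h; rewrite ?mem_head.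
by apply: h; rewrite inE jl orbT.
Qed.

(** [P] is the invariant until [k0] is read, [Q] the one from then on. *)
Lemma foldl_reach (T : Type) (S : eqType) (g : T -> S -> T) (P Q : T -> Prop)
    (l : seq S) z k0 :
  (forall s k, k \in l -> P s -> P (g s k)) ->
  (forall s k, k \in l -> Q s -> Q (g s k)) ->
  k0 \in l -> (forall s, P s -> Q (g s k0)) -> P z -> Q (foldl g z l).
Proof.
move=> hP hQ k0l; case/splitPr: k0l hP hQ => l1 l2 hP hQ h Pz.
rewrite foldl_cat /=; apply: foldl_inv => [s k kl|].
  by apply: hQ => //; rewrite mem_cat inE kl !orbT.
by apply: h; apply: foldl_inv => // s k kl; apply: hP => //; rewrite mem_cat kl.
Qed.

Section Extreme.
Variables (al be : nat -> R) (ks : seq nat) (f : nat).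
Hypothesis fks : f \in ks.
Hypothesis f0 : (al f != 0) || (be f != 0).

(** Positions relative to the ray through generator [f]: [half] is the closed half-plane on its
    counterclockwise side, where all generators will lie, and [up] its interior; [line] also admits
    zero and the opposite ray. *)
Let pos (s : R * R * nat) :=
  exists2 mu, 0 < mu & s.1 = (mu * al f, mu * be f).
Let line (s : R * R * nat) := exists mu, s.1 = (mu * al f, mu * be f).
Let up (s : R * R * nat) := 0 < al f * s.1.2 - be f * s.1.1.
Let half (s : R * R * nat) := 0 <= al f * s.1.2 - be f * s.1.1.

Lemma collinear (p q : R) : al f * q - be f * p = 0 ->
  exists mu, (p, q) = (mu * al f, mu * be f).
Proof.
move=> h; have [a0|a0] := eqVneq (al f) 0.
  move: f0 h; rewrite a0 eqxx /= mul0r sub0r => b0 /eqP.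
  rewrite oppr_eq0 mulf_eq0 (negPf b0) => /eqP ->.
  by exists (q / be f); rewrite mulr0 divfK.
exists (p / al f); rewrite divfK //; congr (_, _).
by apply: (mulfI a0); rewrite (subr0_eq h); field.
Qed.

Let scaled0 (mu : R) : mu != 0 -> (mu * al f != 0) || (mu * be f != 0).
Proof. by move=> mu0; rewrite !mulf_eq0 !negb_or mu0. Qed.

Let scaled0E (mu : R) : (mu * al f != 0) || (mu * be f != 0) = (mu != 0).
Proof.
by have [->|/scaled0//] := eqVneq mu 0; rewrite !mul0r eqxx.
Qed.

(** In the first pass, reading [k0] moves the direction off zero and off the opposite ray, into [G].
    In the second, reading [f] puts it on the ray, where it stays; so the third changes nothing. *)
Lemma wrap_extreme_wide k0 :
  {in ks, forall k, 0 <= al f * be k - be f * al k} ->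
  k0 \in ks -> 0 < al f * be k0 - be f * al k0 ->
  exists2 mu, 0 < mu & gift_wrap al be ks = (mu * al f, mu * be f, 0%N).
Proof.
move=> val k0s k0p; pose G s := up s \/ pos s.
have step_pos s k : k \in ks -> pos s -> pos (wrap_step al be s k).
  move=> kk [mu mu0 E]; rewrite /wrap_step E /= scaled0 ?gt_eqF //=.
  have -> : 0 <= mu * al f * be k - mu * be f * al k.
    by rewrite -!mulrA -mulrBr mulr_ge0 ?val // ltW.
  by exists mu.
have step_half s k : k \in ks -> half s -> half (wrap_step al be s k).
  by move=> kk hs; rewrite /wrap_step; case: ifP => // _; apply: val.
have step_G s k : k \in ks -> G s -> G (wrap_step al be s k).
  move=> kk [us|/(step_pos _ _ kk) ps]; last by right.
  rewrite /wrap_step; case: ifP => [_|]; first by left.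
  have s0 : (s.1.1 != 0) || (s.1.2 != 0).
    apply: contraTT us; rewrite negb_or !negbK => /andP[/eqP h1 /eqP h2].
    by rewrite /up h1 h2 !mulr0 subrr ltxx.
  rewrite s0 /= => /negbT; rewrite -ltNge => dk.
  (* A replacement on the line of [f] is strictly clockwise of a direction above that line, hence a
     positive multiple of [f]. *)
  have [z|nz] := eqVneq (al f * be k - be f * al k) 0; last first.
    by left; rewrite /up /= lt_neqAle eq_sym nz val.
  right; have [mu [E1 E2]] := collinear z; exists mu; last by rewrite /= E1 E2.
  move: dk; rewrite E1 E2.
  have -> : s.1.1 * (mu * be f) - s.1.2 * (mu * al f) =
    - (mu * (al f * s.1.2 - be f * s.1.1)) by ring.
  by rewrite oppr_lt0 pmulr_lgt0.
have f_pos s : G s -> pos (wrap_step al be s f).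
  case=> [us|ps]; last exact: step_pos.
  rewrite /wrap_step ifN; first by exists 1; rewrite ?mul1r.
  rewrite negb_and -ltNge -oppr_gt0 opprB [s.1.2 * _]mulrC [s.1.1 * _]mulrC.
  by rewrite -/(up s) us orbT.
have k0_G s : half s -> G (wrap_step al be s k0).
  rewrite /half le_eqVlt => /predU1P[z|us]; last by apply: step_G => //; left.
  rewrite /wrap_step; case: ifP => [/andP[s0 h]|_]; last by left.
  have [mu [E1 E2]] := collinear (esym z).
  right; exists mu; last by rewrite [LHS]surjective_pairing E1 E2.
  have mu0 : mu != 0 by rewrite -scaled0E -E1 -E2.
  rewrite lt_neqAle eq_sym mu0 /=; move: h; rewrite E1 E2 -!mulrA -mulrBr.
  by rewrite pmulr_lge0.
have [mu mu0 E] : pos (wrap_pass al be ks (wrap_pass al be ks (0, 0)).1).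
  apply: (foldl_reach step_G step_pos fks f_pos).
  apply: (foldl_reach step_half step_G k0s k0_G).
  by rewrite /half /= !mulr0 subrr.
exists mu => //; rewrite /gift_wrap E; apply: wrap_pass_fixed => /= [|k kk].
  by rewrite scaled0 ?gt_eqF.
by rewrite -!mulrA -mulrBr mulr_ge0 ?val // ltW.
Qed.

(** On a line all cross products vanish, so wrapping stops at the first nonzero generator, whose
    sign relative to [f] is arbitrary. Exchanging the coordinates changes no decision, so both runs
    stop at the same generator. *)
Lemma wrap_extreme_flat : {in ks, forall k, al f * be k - be f * al k = 0} ->
  exists2 mu, mu != 0 & gift_wrap al be ks = (mu * al f, mu * be f, 0%N) /\
    gift_wrap be al ks = (mu * be f, mu * al f, 0%N).
Proof.
move=> flat; pose nz (s : R * R * nat) := exists2 mu, mu != 0 & s.1 = (mu * al f, mu * be f).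
have stepE s k : k \in ks -> line s ->
    wrap_step al be s k = if (s.1.1 != 0) || (s.1.2 != 0) then s else (al k, be k, 1%N).
  move=> kk [mu E]; rewrite /wrap_step E /= -!mulrA -mulrBr flat // mulr0 lexx andbT.
  by [].
have step_line s k : k \in ks -> line s -> line (wrap_step al be s k).
  move=> kk ls; rewrite stepE //; case: ifP => // _.
  exact: collinear (flat _ kk).
have step_nz s k : k \in ks -> nz s -> nz (wrap_step al be s k).
  move=> kk [mu mu0 E]; rewrite stepE //; last by exists mu.
  by rewrite E /= scaled0 //; exists mu.
have f_nz s : line s -> nz (wrap_step al be s f).
  move=> [mu E]; rewrite stepE //; last by exists mu.
  rewrite E /= scaled0E; case: eqVneq => [_|mu0]; last by exists mu.
  by exists 1; rewrite ?oner_eq0 ?mul1r.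
have line0 : line ((0, 0), 0%N) by exists 0; rewrite !mul0r.
have [mu mu0 E] : nz (wrap_pass al be ks (wrap_pass al be ks (0, 0)).1).
  apply: (foldl_reach step_line step_nz fks f_nz).
  have [nu E] : line (wrap_pass al be ks (0, 0)) by apply: foldl_inv.
  by exists nu; rewrite /= E.
exists mu => //.
have fixed a b : (a != 0) || (b != 0) -> {in ks, forall k, a * be k - b * al k = 0} ->
    wrap_pass al be ks (a, b) = (a, b, 0%N) /\ wrap_pass be al ks (b, a) = (b, a, 0%N).
  move=> ab0 h; split; apply: wrap_pass_fixed => //=.
  - by move=> k /h ->.
  - by rewrite orbC.
  - by move=> k /h E'; rewrite -opprB E' oppr0.
have fl : {in ks, forall k, mu * al f * be k - mu * be f * al k = 0}.
  by move=> k /flat h; rewrite -!mulrA -mulrBr h mulr0.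
have [F1 F2] := fixed _ _ (scaled0 mu0) fl.
pose sw (s : R * R * nat) := (s.1.2, s.1.1, s.2).
have swap_pass c n : line (c, n) ->
    wrap_pass be al ks (c.2, c.1) = sw (wrap_pass al be ks c).
  move=> ln; rewrite /wrap_pass.
  have {ln} : line (c, 0%N) := ln.
  have -> : (c.2, c.1, 0%N) = sw (c, 0%N) by [].
  move: (c, 0%N) => s.
  have : {subset ks <= ks} by [].
  elim: {1 3 4}ks s => //= k l IH s sub ls.
  have kk : k \in ks by rewrite sub ?mem_head.
  have -> : wrap_step be al (sw s) k = sw (wrap_step al be s k).
    rewrite stepE // /wrap_step orbC /sw /=.
    case: ls => nu Es; rewrite Es /= -!mulrA -mulrBr -opprB flat // oppr0 mulr0 lexx andbT.
    by case: ifP; rewrite ?Es.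
  by apply: IH => [j jl|]; [rewrite sub // inE jl orbT | exact: step_line].
have [nu E1] : line (wrap_pass al be ks (0, 0)) by apply: foldl_inv.
rewrite /gift_wrap E; split => //.
rewrite [wrap_pass be al ks (0, 0)](swap_pass (0, 0) 0%N line0) /=.
rewrite (swap_pass _ 0%N); last by exists nu.
by rewrite /= E.
Qed.

(** In the flat case the sign of [mu] cannot be prescribed. Exchanging the coordinates reverses the
    normal, so there a negative [mu] is the right one. *)
Lemma wrap_extreme :
  {in ks, forall k, 0 <= al f * be k - be f * al k} ->
  (exists2 mu, 0 < mu & gift_wrap al be ks = (mu * al f, mu * be f, 0%N)) \/
  (exists2 mu, mu < 0 & gift_wrap be al ks = (mu * be f, mu * al f, 0%N)).
Proof.
move=> val.
have [/hasP[k0 k0s k0p]|/hasPn flat] :=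
    boolP (has (fun k => 0 < al f * be k - be f * al k) ks).
  by left; apply: wrap_extreme_wide k0p.
have [|mu mu0 [E1 E2]] := wrap_extreme_flat.
  by move=> k kk; apply/eqP; rewrite eq_le val // leNgt flat.
have [lt0|gt0] := ltP mu 0; first by right; exists mu.
by left; exists mu => //; rewrite lt_neqAle eq_sym mu0.
Qed.
End Extreme.
End Wrap.

(** * Minima of points of a convex hull *)

Lemma bigmin_mem d (T : orderType d) (I : eqType) (x : T) (r : seq I) (F : I -> T) :
  \big[Order.min/x]_(i <- r) F i \in x :: map F r.
Proof.
elim: r => [|i r IH]; first by rewrite big_nil mem_head.
rewrite big_cons /= !inE; rewrite inE in IH.
by case: leP => _; rewrite ?eqxx ?orbT //; case/orP: IH => ->; rewrite ?orbT.
Qed.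

Lemma head_fset_mem (T : choiceType) (P : {fset T}) (x : T) :
  P != fset0 -> head x P \in (P : seq T).
Proof.
case/fset0Pn=> q; rewrite -[q \in P]/(q \in (P : seq T)).
by case: (P : seq T) => // q' l _; apply: mem_head.
Qed.

Section Hull.
Variables (R : realType) (n : nat).
Implicit Types (X Y : set 'rV[R]_n) (x p : 'rV[R]_n).

Lemma conv_hull_le X (c : 'I_n -> R) (e : R) :
  (forall p, X p -> \sum_j c j * p 0 j <= e) ->
  forall p, conv_hull X p -> \sum_j c j * p 0 j <= e.
Proof.
move=> XP p; apply: (@smallest_sub _ _ _ [set q : 'rV[R]_n | \sum_j c j * q 0 j <= e]) => //.
move=> x y l; rewrite !in_setE /= => hx hy.
have -> : \sum_j c j * (conv l x y : 'rV[R]_n) 0 j =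
   l%:num * (\sum_j c j * x 0 j) + (1 - l%:num) * (\sum_j c j * y 0 j).
  rewrite !mulr_sumr -big_split; apply: eq_bigr => j _ /=.
  by rewrite /conv /= !mxE /onem; ring.
have -> : e = l%:num * e + (1 - l%:num) * e by ring.
by rewrite lerD // ler_wpM2l // ?subr_ge0 ?le1 // ge0.
Qed.

Lemma conv_hull_combination X (I : finType) (v : I -> 'rV[R]_n) (lam : I -> R) :
  (forall k, X (v k)) -> (forall k, 0 <= lam k) -> \sum_k lam k = 1 ->
  conv_hull X (\sum_k lam k *: v k).
Proof.
move=> Xv l0 l1 Y [/= cY XY].
have cvx x y (u w : R) : Y x -> Y y -> 0 <= u -> 0 <= w -> u + w = 1 -> Y (u *: x + w *: y).
  move=> Yx Yy u0 w0 uw.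
  have u1 : u <= 1 by rewrite -uw lerDl.
  have := cY x y (Itv01 u0 u1); rewrite !in_setE => /(_ Yx Yy).
  by rewrite /conv /= /onem -uw addrAC subrr add0r.
have [k0 _] : exists k : I, true.
  apply/existsP; apply: contraPT l1; rewrite negb_exists => /forallP h.
  by rewrite big1 => [|k]; [apply/eqP; rewrite eq_sym oner_eq0 | have := h k].
(* Binary convexity is applied to partial combinations normalised by their total weight, which is
   why only positive totals are considered. *)
suff gen r : (\sum_(k <- r) lam k = 0 -> True) /\ (0 < \sum_(k <- r) lam k ->
    Y ((\sum_(k <- r) lam k)^-1 *: \sum_(k <- r) lam k *: v k)).
  by have [_] := gen (index_enum I); rewrite l1 invr1 scale1r; apply.
split => //; elim: r => [|k r IH]; first by rewrite big_nil ltxx.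
rewrite !big_cons; set s := \sum_(_ <- r) _; set w := \sum_(_ <- r) _ => ks.
have : 0 <= s by apply: sumr_ge0.
rewrite le_eqVlt => /predU1P[s0|s0].
  have w0 : w = 0.
    rewrite /w big_seq; apply: big1 => j jr.
    have /eqP := esym s0; rewrite psumr_eq0 // => /allP /(_ _ jr) /eqP ->.
    by rewrite scale0r.
  move: ks; rewrite -s0 w0 !addr0 => lk.
  by rewrite scalerA mulVf ?scale1r ?gt_eqF //; apply: XY.
have -> : (lam k + s)^-1 *: (lam k *: v k + w) =
    (lam k / (lam k + s)) *: v k + (s / (lam k + s)) *: (s^-1 *: w).
  rewrite scalerDr !scalerA mulrC; congr (_ *: _ + _ *: _).
  by rewrite mulrAC divff ?mul1r // gt_eqF.
apply: cvx; rewrite ?divr_ge0 ?addr_ge0 ?(ltW s0) //.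
- exact: XY.
- exact: IH.
- by rewrite -mulrDl divff // gt_eqF.
Qed.

(** An element of the finite set attaining the minimum in coordinate i is the witness for i.
    Conversely the n witnesses together have minimum x; [0 < n] makes their set nonempty. *)
Lemma Fmin_coord X x : (0 < n)%N ->
  Fmin X x <-> forall i, exists p, [/\ X p, forall j, x 0 j <= p 0 j & p 0 i = x 0 i].
Proof.
move=> n0; split.
  move=> [P [/= P0 PX] <-] i.
  have hP : head 0 P \in (P : seq _).
    exact: head_fset_mem.
  have mP j q : q \in (P : seq _) -> (fmin P) 0 j <= q 0 j.
    by move=> qP; rewrite mxE; apply: ge_bigmin_seq.
  have [q qP qE] : exists2 q, q \in (P : seq _) & (fmin P) 0 i = q 0 i.
    rewrite mxE; have := bigmin_mem (head 0 P 0 i) P (fun q : 'rV_n => q 0 i).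
    rewrite inE => /predU1P[->|/mapP[q qP ->]]; first by exists (head 0 P).
    by exists q.
  by exists q; split => // [|j]; [exact: PX | exact: mP].
move=> h; have /choice[p ph] := h.
have pP i : p i \in [fset p i | i in 'I_n]%fset by apply/imfsetP; exists i.
have P0 : [fset p i | i in 'I_n]%fset != fset0 by apply/fset0Pn; exists (p (Ordinal n0)).
exists [fset p i | i in 'I_n]%fset.
  by split=> //=;
    move=> q /= /imfsetP[i _ ->]; have [] := ph i.
apply/rowP => j; rewrite mxE; apply/le_anti/andP; split.
  by have [_ _ <-] := ph j; apply: ge_bigmin_seq.
have le q : q \in [fset p i | i in 'I_n]%fset -> x 0 j <= q 0 j.
  by case/imfsetP => i _ ->; have [_ + _] := ph i; apply.
by rewrite big_seq; apply: le_bigmin => //; apply: le; apply: head_fset_mem.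
Qed.
End Hull.

(** * Separation by a facet *)

(** Indexed by naturals and 0 out of range, exactly like the real array of the initial state. *)
Definition coord (R : realType) (n : nat) (x : 'rV[R]_n) (b : nat) : R :=
  oapp (fun j : 'I_n => x 0 j) 0 (insub b).

Lemma coordE (R : realType) (n : nat) (x : 'rV[R]_n) (j : 'I_n) : coord x j = x 0 j.
Proof. by rewrite /coord valK. Qed.

(* The point x in homogeneous coordinates, with the sign chosen so that the
   halfspaces a . x <= b containing x become 0 <= gdot (homog x) (a, b). *)
Definition homog (R : realType) (n : nat) (x : 'rV[R]_n) (b : nat) : R :=
  if (b < n)%N then - coord x b else 1.

(** The rows below the points form an identity matrix. They serve as generators and also, once
    column operations are applied to the table, as a record of those operations, from which normals
    are read off. *)
Definition gen (R : realType) (n : nat) (s : seq 'rV[R]_n) (k b : nat) : R :=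
  if (k < size s)%N then homog (nth 0 s k) b else (k == size s + b)%N%:R.

Definition gdot (R : realType) (n : nat) (v a : nat -> R) : R :=
  \sum_(b < n.+1) v b * a b.

(* Row size s + n of gen is the homogenising unit vector, and row size s + i is
   the direction along which no decrease is allowed. *)
Definition is_gen (R : realType) (n : nat) (s : seq 'rV[R]_n) (i k : nat) : bool :=
  (k < size s + n)%N && (k != size s + i)%N.

Definition gvalid (R : realType) (n : nat) (s : seq 'rV[R]_n) (i : nat) (a : nat -> R) :=
  forall k, is_gen s i k -> 0 <= gdot n (gen s k) a.

Section Gen.
Variables (R : realType) (n : nat) (s : seq 'rV[R]_n).
Let m := size s.

Lemma gdot_homog (x : 'rV[R]_n) a : gdot n (homog x) a = a n - \sum_(j < n) a j * x 0 j.
Proof.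
rewrite /gdot big_ord_recr /= /homog ltnn mul1r addrC; congr (_ + _).
rewrite -sumrN; apply: eq_bigr => j _.
by rewrite /= ltn_ord coordE mulNr mulrC.
Qed.

Lemma gen_point k : (k < m)%N -> gen s k = homog (nth 0 s k).
Proof. by move=> km; rewrite funeqE => b; rewrite /gen km. Qed.

Lemma gdot_unit j a : (j < n.+1)%N -> gdot n (gen s (m + j)) a = a j.
Proof.
move=> jn; rewrite /gdot (bigD1 (Ordinal jn)) //= big1.
  by rewrite addr0 /gen ltnNge leq_addr /= eqxx mul1r.
move=> b /eqP bj; rewrite /gen ltnNge leq_addr /= eqn_add2l.
by case: eqP => [jb|]; rewrite ?mul0r //; case: bj; apply: val_inj.
Qed.

Let X := [set x : 'rV[R]_n | x \in s].

(** Compare x with its witness p for coordinate i: [a] is nonnegative at the unit vectors other than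
    i, and p and x agree at i, so passing from p down to x does not increase the left-hand side. *)
Lemma gvalid_sound (i : 'I_n) a x :
  gvalid s i a -> Fmin (conv_hull X) x -> 0 <= gdot n (homog x) a.
Proof.
move=> va xF; have n0 : (0 < n)%N by apply: leq_ltn_trans (ltn_ord i).
have /(Fmin_coord _ _ n0)/(_ i)[p [pX xp pi]] := xF.
rewrite gdot_homog subr_ge0.
have : \sum_(j < n) a j * p 0 j <= a n.
  apply: (conv_hull_le (X := X)) pX => q; rewrite /X /= => qs.
  have := va (index q s); rewrite /is_gen.
  have qm : (index q s < size s)%N by rewrite index_mem.
  rewrite (ltn_addr _ qm) neq_ltn (ltn_addr _ qm) => /(_ isT).
  by rewrite gen_point // nth_index // gdot_homog subr_ge0.
apply: le_trans; apply: ler_sum => j _.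
have [->|ji] := eqVneq j i; first by rewrite pi.
rewrite ler_wpM2l //; have := va (m + j)%N.
by rewrite gdot_unit ?ltnS 1?ltnW // /is_gen ltn_add2l ltn_ord eqn_add2l; apply.
Qed.

Let M := (m + n.-1)%N.
Let V i (k : 'I_M) : 'rV[R]_n.+1 := \row_b gen s (bump (m + i) k) b.

Let dotV i a k : dot a (V i k) = gdot n (gen s (bump (m + i) k)) (coord a).
Proof. by apply: eq_bigr => b _; rewrite mxE coordE mulrC. Qed.

Let W (x : 'rV[R]_n) : 'rV[R]_n.+1 := \row_b homog x b.

Let dotW a x : dot a (W x) = gdot n (homog x) (coord a).
Proof. by apply: eq_bigr => b _; rewrite mxE coordE mulrC. Qed.

Lemma is_gen_bump i k : (k < M)%N -> (i < n)%N -> is_gen s i (bump (m + i) k).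
Proof. by rewrite /is_gen /M -/m /bump => kM; case: leqP; lia. Qed.

Lemma bump_is_gen i k : (i < n)%N -> is_gen s i k ->
  exists2 k' : 'I_M, true & k = bump (m + i) k'.
Proof.
move=> ni /andP[km ki]; have h : (unbump (m + i) k < M)%N.
  by move: km ki; rewrite /unbump /M -/m; lia.
by exists (Ordinal h); rewrite //= unbumpK.
Qed.

Lemma gvalidP i a : (i < n)%N ->
  (forall k, 0 <= dot a (V i k)) -> gvalid s i (coord a).
Proof. by move=> ni va k /(bump_is_gen ni)[k' _ ->]; rewrite -dotV. Qed.

(** Vanishing at the unit vectors leaves only the coordinates i and n of [c]; two points differing
    in coordinate i force these to vanish too. *)
Lemma gens_span (i : 'I_n) (y z : 'rV[R]_n) c : (forall k, dot c (V i k) = 0) ->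
  dot c (W y) = 0 -> dot c (W z) = 0 -> y 0 i <> z 0 i -> c = 0.
Proof.
move=> cV cy cz yz.
have cj (j : 'I_n) : j != i -> coord c j = 0.
  move=> ji; have := @bump_is_gen i (m + j) (ltn_ord i).
  rewrite /is_gen ltn_add2l ltn_ord eqn_add2l ji => /(_ isT)[k _ E].
  by rewrite -(@gdot_unit j) ?ltnS 1?ltnW // E -dotV.
have ci : coord c i = 0.
  have E (z' : 'rV[R]_n) : dot c (W z') = 0 -> coord c i * z' 0 i = coord c n.
    rewrite dotW gdot_homog (bigD1 i) //= big1 ?addr0 => [/subr0_eq//|j /cj ->].
    exact: mul0r.
  have /eqP : coord c i * (y 0 i - z 0 i) = 0 by rewrite mulrBr !E ?subrr.
  by rewrite mulf_eq0 subr_eq0 => /orP[/eqP//|/eqP/yz].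
have c0 (j : 'I_n) : coord c j = 0 by have [->|/cj] := eqVneq j i.
apply/rowP => b; rewrite mxE -coordE; have [bn|nb] := ltnP b n.
  by rewrite (c0 (Ordinal bn)).
have -> : b = n :> nat by have := ltn_ord b; lia.
move: cy; rewrite dotW gdot_homog big1 ?subr0 // => j _.
by rewrite c0 mul0r.
Qed.

Lemma gens_point (i : 'I_n) c k : (k < m)%N -> (forall k, dot c (V i k) = 0) ->
  dot c (W (nth 0 s k)) = 0.
Proof.
move=> km cV; have := @bump_is_gen i k (ltn_ord i).
rewrite /is_gen (ltn_addr _ km) neq_ltn (ltn_addr _ km) => /(_ isT)[k' _ E].
by rewrite dotW -gen_point // E -dotV.
Qed.

Let upper (i : 'I_n) (x : 'rV[R]_n) :=
  exists p, [/\ conv_hull X p, forall j, x 0 j <= p 0 j & p 0 i = x 0 i].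

(** The homogenising coordinate of the equation says that the weights of the points sum to 1; the
    others say that x is their convex combination minus nonnegative multiples of unit vectors other
    than i. *)
Lemma gens_cone_upper (i : 'I_n) (x : 'rV[R]_n) (lam : 'I_M -> R) :
  (forall k, 0 <= lam k) -> W x = \sum_k lam k *: V i k -> upper i x.
Proof.
move=> l0 WE.
have bl (k : 'I_m) : bump (m + i) k = k by have := ltn_ord k; rewrite /bump; lia.
have WEb b : (b < n.+1)%N -> homog x b =
    \sum_(k < m) lam (lshift _ k) * homog (nth 0 s k) b +
    \sum_(l < n.-1) lam (rshift m l) * (bump (m + i) (m + l) == m + b)%N%:R.
  move=> bn; have := congr1 (fun v : 'rV_n.+1 => v 0 (Ordinal bn)) WE.
  rewrite mxE summxE big_split_ord /= => ->; congr (_ + _); apply: eq_bigr => k _.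
    by rewrite !mxE /= bl gen_point.
  by rewrite !mxE /= /gen ifN // -leqNgt /bump addnCA leq_addr.
have l1 : \sum_(k < m) lam (lshift _ k) = 1.
  have := WEb n (ltnSn n); rewrite /homog ltnn => ->.
  rewrite [X in _ + X]big1 ?addr0.
    by apply: eq_bigr => k _; rewrite mulr1.
  move=> l _; case: eqP => [|_]; last by rewrite mulr0.
  by have := ltn_ord l; have := ltn_ord i; rewrite /bump; lia.
pose p := \sum_(k < m) lam (lshift _ k) *: nth 0 s k.
have xE (j : 'I_n) : x 0 j = p 0 j -
    \sum_(l < n.-1) lam (rshift m l) * (bump (m + i) (m + l) == m + j)%N%:R.
  have := WEb j (ltnW (ltn_ord j)); rewrite /homog ltn_ord coordE => h.
  rewrite -[LHS]opprK h opprD; congr (_ + _); rewrite /p summxE -sumrN.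
  by apply: eq_bigr => k _; rewrite !mxE coordE mulrN opprK.
exists p; split=> [|j|].
- apply: conv_hull_combination => // k; rewrite /X /=; exact: mem_nth.
- by rewrite xE gerBl sumr_ge0 // => l _; rewrite mulr_ge0.
- rewrite xE big1 ?subr0 // => l _.
  by rewrite [_ == (m + i)%N]eq_sym (negPf (neq_bump _ _)) mulr0.
Qed.

(** If all points agree with x in coordinate [i0], the generators for [i0] do not span. But then so
    does the whole hull, so a witness for any other coordinate would be one for [i0], and i may be
    changed to a coordinate where two points differ. *)
Lemma non_upper_span (i0 : 'I_n) x : (1 < m)%N -> uniq s -> ~ upper i0 x ->
  exists2 i, ~ upper i x &
    forall c, (forall k, dot c (V i k) = 0) -> dot c (W x) = 0 -> c = 0.
Proof.
move=> m1 us ni0.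
have [[k km kx]|nk] := pselect (exists2 k, (k < m)%N & x 0 i0 <> (nth 0 s k) 0 i0).
  exists i0 => // c cV cx; apply: (gens_span cV cx _ kx).
  exact: gens_point.
have xi0 k : (k < m)%N -> (nth 0 s k) 0 i0 = x 0 i0.
  by move=> km; apply: contrapT => h; apply: nk; exists k => // /esym.
have [i ni] : exists i, (nth 0 s 0) 0 i <> (nth 0 s 1) 0 i.
  apply: contrapT => h; have /eqP : nth 0 s 0 = nth 0 s 1.
    by apply/rowP => j; apply: contrapT => h'; apply: h; exists j.
  by rewrite nth_uniq // ltnW.
exists i.
  move=> [p [pX xp pi]]; apply: ni0; exists p; split => //.
  have le1 c e : (forall k, (k < m)%N -> c * (nth 0 s k) 0 i0 <= e) -> c * p 0 i0 <= e.
    move=> h; have E (q : 'rV[R]_n) :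
        \sum_(j < n) (if j == i0 then c else 0) * q 0 j = c * q 0 i0.
      rewrite (bigD1 i0) //= eqxx big1 ?addr0 // => j /negPf ->.
      by rewrite mul0r.
    rewrite -E; apply: conv_hull_le pX => q; rewrite /X /= => qs.
    by rewrite E -(nth_index 0 qs); apply: h; rewrite index_mem.
  have u := le1 1 (x 0 i0); have l := le1 (-1) (- x 0 i0).
  apply/eqP; rewrite eq_le; apply/andP; split.
    by rewrite -[p 0 i0]mul1r; apply: u => k km; rewrite xi0 // mul1r.
  by rewrite -lerN2 -[- p 0 i0]mulN1r; apply: l => k km; rewrite xi0 // mulN1r.
move=> c cV _; apply: (gens_span cV _ _ ni); apply: gens_point cV => //; exact: ltnW.
Qed.

(** The functionals [c] dual to the tight generators express their linear independence. *)
Lemma facet_separation x : (0 < n)%N -> (1 < m)%N -> uniq s ->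
  ~ Fmin (conv_hull X) x ->
  exists i (a : nat -> R) (ks : seq nat),
    [/\ (i < n)%N, gvalid s i a, gdot n (homog x) a < 0,
     [/\ size ks = n, sorted ltn ks & {in ks, forall k, (k < M)%N}] &
     {in ks, forall k, gdot n (gen s (bump (m + i) k)) a = 0 /\
        exists c, {in ks, forall k', gdot n (gen s (bump (m + i) k')) c = (k == k')%:R}}].
Proof.
move=> n0 m1 us xF.
have {xF} [i0 ni0] : exists i, ~ exists p,
    [/\ conv_hull X p, forall j, x 0 j <= p 0 j & p 0 i = x 0 i].
  by apply/existsNP => h; apply: xF; apply/Fmin_coord.
have [i ni span] := non_upper_span m1 us ni0.
have [[lam l0 WE]|[a va ax]] := farkas (V i) (W x).
  by case: ni; exact: gens_cone_upper WE.
have [a' [K [C [va' ax' aK CK]]]] := extremal_separation va ax span (ltnSn n).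
have Kinj : injective K.
  move=> l l' E; apply/eqP; have := CK l l'; rewrite -E CK eqxx.
  by case: eqP => // _ /eqP; rewrite oner_eq0.
pose ks := sort leq [seq (K l : nat) | l <- enum 'I_n].
have ksP k : k \in ks -> exists l, k = K l.
  by rewrite mem_sort => /mapP[l _ ->]; exists l.
exists i, (coord a'), ks; split.
- exact: ltn_ord.
- exact: gvalidP.
- by rewrite -dotW.
- split; first by rewrite size_sort size_map size_enum_ord.
    rewrite ltn_sorted_uniq_leq sort_uniq map_inj_uniq ?enum_uniq => [|l l' /val_inj/Kinj//].
    by apply: sort_sorted; exact: leq_total.
  by move=> k /ksP[l ->].
- move=> k /ksP[l ->]; rewrite -dotV aK; split => //.
  exists (coord (C l)) => k' /ksP[l' ->]; rewrite -dotV CK.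
  by rewrite (inj_eq val_inj) (inj_eq Kinj).
Qed.
End Gen.

(** * Elimination of the ridge *)

(* If the row is zero the pivot is junk, but then the division by zero makes
   the elimination step the identity. *)
Definition pivot (R : realType) (n : nat) (v : nat -> R) : nat :=
  foldl (fun p b => if v b != 0 then b else p) 0%N (iota 0 n.+1).

(** Read along rows, this subtracts a multiple of row [u] from row [k], so functionals orthogonal to
    row [u] keep their values. Read along columns, it subtracts multiples of the pivot column, so
    the identity rows record it. The pivot column itself becomes 0. *)
Definition elim_row (R : realType) (n : nat) (H : nat -> nat -> R) (u k b : nat) : R :=
  H k b - H k (pivot n (H u)) * (H u b / H u (pivot n (H u))).

(** After n - 1 independent eliminations exactly two columns survive, recognised by their nonzero
    diagonal entry in the identity block. The default 0 keeps the result in range for dependent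
    rows. *)
Definition last_two (n : nat) (P : pred nat) : nat * nat :=
  foldl (fun gh b => if P b then (gh.2, b) else gh) (0, 0)%N (iota 0 n.+1).

(** The functional whose value at generator k is the cross product of [c] with the reduced row k in
    the plane of columns [g] and [h]. *)
Definition normal (R : realType) (m : nat) (H : nat -> nat -> R) (g h : nat)
  (c : R * R) (j : nat) : R := c.1 * H (m + j)%N h - c.2 * H (m + j)%N g.

Definition gens (R : realType) (n : nat) (s : seq 'rV[R]_n) (i : nat) : seq nat :=
  [seq k <- iota 0 (size s + n) | k != size s + i]%N.

Lemma foldl_filter (T S : Type) (f : T -> S -> T) (P : pred S) z l :
  foldl (fun t x => if P x then f t x else t) z l = foldl f z (filter P l).
Proof. by elim: l z => //= x l IH z; rewrite IH; case: (P x). Qed.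

Lemma count_predD1 (T : eqType) (P : pred T) (l : seq T) p :
  uniq l -> p \in l -> P p -> count P l = (count (fun b => P b && (b != p)) l).+1.
Proof.
move=> ul pl Pp; rewrite -size_filter -(count_predC (fun b => b != p)) !count_filter addnC.
have -> : count (predI (predC (fun b => b != p)) P) l = count_mem p l.
  by apply: eq_count => b /=; rewrite negbK; case: eqP => // ->.
by rewrite count_uniq_mem // pl; congr _.+1; apply: eq_count => b /=; apply: andbC.
Qed.

Section Elim.
Variables (R : realType) (n : nat) (s : seq 'rV[R]_n).
Let m := size s.

Lemma gen_unit j b : gen s (m + j) b = (j == b)%:R.
Proof. by rewrite /gen ifN -?leqNgt ?leq_addr // eqn_add2l. Qed.

Lemma pivotP (v : nat -> R) : (pivot n v < n.+1)%N /\
  (forall b, (b < n.+1)%N -> v b != 0 -> v (pivot n v) != 0).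
Proof.
rewrite /pivot foldl_filter.
set l := filter _ _; have lP b : b \in l = (v b != 0) && (b < n.+1)%N.
  by rewrite mem_filter mem_iota.
elim/last_ind: l lP => [|l x _] lP /=.
  by split => // b bn vb; have := lP b; rewrite bn vb.
rewrite foldl_rcons; have := lP x.
by rewrite mem_rcons mem_head => /esym/andP[vx ->].
Qed.

Lemma gdotZB (v w : nat -> R) e c :
  gdot n (fun b => v b - e * w b) c = gdot n v c - e * gdot n w c.
Proof. by rewrite /gdot mulr_sumr -sumrB; apply: eq_bigr => b _; ring. Qed.

Lemma gdotZBr (v w c : nat -> R) e :
  gdot n c (fun b => v b - w b * e) = gdot n c v - gdot n c w * e.
Proof. by rewrite /gdot mulr_suml -sumrB; apply: eq_bigr => b _; ring. Qed.

(** True for the identity matrix at the start, and preserved because a column operation acts on all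
    rows alike. *)
Lemma elim_column us k b : (b < n.+1)%N ->
  let H := foldl (elim_row n) (gen s) us in
  H k b = gdot n (gen s k) (fun j => H (m + j)%N b).
Proof.
elim/last_ind: us b => [|us u IH] b bn /=.
  rewrite /gdot (bigD1 (Ordinal bn)) //= big1.
    by rewrite gen_unit eqxx mulr1 addr0.
  move=> j /eqP jb; rewrite gen_unit.
  by case: eqP => [h|]; rewrite ?mulr0 //; case: jb; apply: val_inj.
rewrite foldl_rcons; move: IH; set H := foldl _ _ _ => IH.
rewrite /elim_row; have [pn _] := pivotP (H u).
by rewrite gdotZBr -!IH.
Qed.

Lemma gdot_normal us k g h c : (g < n.+1)%N -> (h < n.+1)%N ->
  let H := foldl (elim_row n) (gen s) us in
  gdot n (gen s k) (normal m H g h c) = c.1 * H k h - c.2 * H k g.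
Proof.
move=> gn hn H; rewrite /normal.
have := elim_column us k gn; have := elim_column us k hn; rewrite -/H /= => -> ->.
by rewrite /gdot !mulr_sumr -sumrB; apply: eq_bigr => b _; ring.
Qed.

Lemma elim_orthogonal us c k : {in us, forall u, gdot n (gen s u) c = 0} ->
  gdot n (foldl (elim_row n) (gen s) us k) c = gdot n (gen s k) c.
Proof.
elim/last_ind: us k => // us u IH k h; rewrite foldl_rcons.
have h' : {in us, forall u, gdot n (gen s u) c = 0}.
  by move=> v vus; apply: h; rewrite mem_rcons inE vus orbT.
move: IH; set H := foldl _ _ _ => IH.
have -> : elim_row n H u k = fun b =>
    H k b - (H k (pivot n (H u)) / H u (pivot n (H u))) * H u b.
  by rewrite funeqE => b; rewrite /elim_row mulrA [in RHS]mulrAC.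
by rewrite gdotZB !IH // [gdot n (gen s u) c]h ?mulr0 ?subr0 // mem_rcons mem_head.
Qed.

(** Linear independence in triangular form, as the elimination needs it, one row at a time. *)
Definition independent (us : seq nat) := forall l, (l < size us)%N ->
  exists2 c, {in take l us, forall u, gdot n (gen s u) c = 0} &
    gdot n (gen s (nth 0%N us l)) c != 0.

(** [P] is the set of surviving columns; each elimination removes exactly its pivot, while the
    identity rows of the surviving columns stay unit vectors. *)
Lemma elim_reduced us : independent us ->
  let H := foldl (elim_row n) (gen s) us in
  exists P : pred nat, (count P (iota 0 n.+1) + size us)%N = n.+1 /\
    (forall b, (b < n.+1)%N -> if P b
       then forall j, (j < n.+1)%N -> H (m + b)%N j = (j == b)%:R
       else forall k, H k b = 0).
Proof.
elim/last_ind: us => [_|us u IH ind] /=.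
  exists predT; rewrite count_predT size_iota addn0; split => // b bn j jn.
  by rewrite gen_unit eq_sym.
have [|P [cP HP]] := IH.
  move=> l lus; have [|c c1 c2] := ind l; first by rewrite size_rcons ltnW.
  exists c; first by move: c1; rewrite -cats1 takel_cat ?(ltnW lus).
  by move: c2; rewrite nth_rcons lus.
rewrite foldl_rcons; set H := foldl _ _ _ in HP *.
set p := pivot n (H u); have [pn pP] := pivotP (H u).
(* The functional separating [u] from the earlier rows has the same value on the reduced row, which
   is therefore not zero. *)
have Hup : H u p != 0.
  have [|c c1 c2] := ind (size us); first by rewrite size_rcons.
  move: c1 c2; rewrite -cats1 take_size_cat // cats1 nth_rcons ltnn eqxx => c1.
  rewrite -(elim_orthogonal _ c1) -/H; apply: contraNN => Hup.
  rewrite /gdot big1 // => b _; have [->|nz] := eqVneq (H u b) 0; first by rewrite mul0r.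
  by case/negP: (pP b (ltn_ord b) nz).
have Pp : P p by apply: contraNT Hup => nP; have := HP p pn; rewrite (negPf nP) => ->.
exists (fun b => P b && (b != p)); split.
  have pI : p \in iota 0 n.+1 by rewrite mem_iota.
  by rewrite size_rcons addnS -addSn -(count_predD1 (iota_uniq _ _) pI Pp).
move=> b bn; have := HP b bn; rewrite /elim_row -/p; case: ifP => Pb Hb /=; last first.
  by move=> k; rewrite !Hb mul0r mulr0 subr0.
case: eqP => [->|bp] /=; first by move=> k; rewrite divff // mulr1 subrr.
move=> j jn; rewrite !Hb //; case: (p =P b) => [E|_]; last by rewrite mul0r subr0.
by case: bp.
Qed.

Lemma elim_plane us : (0 < n)%N -> size us = n.-1 -> independent us ->
  let H := foldl (elim_row n) (gen s) us in
  let: (g, h) := last_two n (fun b => H (m + b)%N b != 0) in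
  [/\ (g < n.+1)%N, (h < n.+1)%N & forall c k, {in us, forall u, gdot n (gen s u) c = 0} ->
    gdot n (gen s k) c = H k g * c g + H k h * c h].
Proof.
move=> n0 sz ind H; have [P [cP HP]] := elim_reduced ind; rewrite -/H in HP.
have PE : {in iota 0 n.+1, (fun b => H (m + b)%N b != 0) =1 P}.
  move=> b; rewrite mem_iota => /= bn; have := HP b bn.
  by case: (P b) => -> //; rewrite ?eqxx ?oner_eq0.
rewrite /last_two foldl_filter (eq_in_filter PE).
have := cP; rewrite sz -size_filter.
have inP b : b \in filter P (iota 0 n.+1) -> (b < n.+1)%N.
  by rewrite mem_filter mem_iota => /andP[].
have sumP c k : gdot n (H k) c = \sum_(b <- filter P (iota 0 n.+1)) H k b * c b.
  rewrite big_filter /gdot -(big_mkord xpredT (fun b => H k b * c b)) /index_iota subn0.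
  rewrite [RHS]big_mkcond big_seq [RHS]big_seq; apply: eq_bigr => b.
  rewrite mem_iota => /= bn; have := HP b bn; case: (P b) => // ->.
  by rewrite mul0r.
case: (filter P _) inP sumP => [|g [|h [|? ?]]] inP sumP /=; rewrite ?addSn; try lia.
move=> _; split; try by apply: inP; rewrite !inE eqxx ?orbT.
move=> c k cus; rewrite -(elim_orthogonal k cus) -/H sumP.
by rewrite !big_cons big_nil addr0.
Qed.

(* One of the two orientations of the plane makes the gift wrapping stop at f,
   or, when all generators are on the line of f, at a multiple of f of the
   right sign. *)
Lemma wrap_normal_pos us (i g h f : nat) (a v : nat -> R) (kap : R) :
  (g < n.+1)%N -> (h < n.+1)%N ->
  let H := foldl (elim_row n) (gen s) us in
  (forall j, (j < n.+1)%N -> a j = kap * (H f g * H (m + j)%N h - H f h * H (m + j)%N g)) ->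
  gvalid s i a -> 0 < kap -> is_gen s i f -> (H f g != 0) || (H f h != 0) ->
  gdot n v a < 0 ->
  exists2 gh, gh \in [:: (g, h); (h, g)] &
    let w := gift_wrap (H^~ gh.1) (H^~ gh.2) (gens s i) in
    w.2 = 0%N /\ gdot n v (normal m H gh.1 gh.2 w.1) < 0.
Proof.
move=> gn hn H aE va kap0 gf f0 neg.
have fg : f \in gens s i by rewrite mem_filter mem_iota andbC.
have scale mu c j : (j < n.+1)%N -> c = (mu * H f g, mu * H f h) ->
    normal m H g h c j = mu / kap * a j.
  by move=> jn ->; rewrite aE // /normal /=; field; rewrite gt_eqF.
have neg' r (b : nat -> R) : (forall j, (j < n.+1)%N -> b j = r * a j) -> 0 < r -> gdot n v b < 0.
  move=> bE r0; rewrite /gdot (eq_bigr (fun j : 'I_n.+1 => r * (v j * a j))).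
    by rewrite -mulr_sumr pmulr_rlt0.
  by move=> j _; rewrite bE //; ring.
have val : {in gens s i, forall k, 0 <= H f g * H k h - H f h * H k g}.
  move=> k; rewrite mem_filter mem_iota => /andP[ki /= km].
  have := va k; rewrite /is_gen km ki => /(_ isT).
  have -> : gdot n (gen s k) a = kap * gdot n (gen s k) (normal m H g h (H f g, H f h)).
    rewrite /gdot mulr_sumr; apply: eq_bigr => j _; rewrite aE // /normal /=; ring.
  by rewrite gdot_normal // pmulr_rge0.
have [[mu mu0 E]|[mu mu0 E]] := wrap_extreme fg f0 val.
  exists (g, h); rewrite ?mem_head //= E /=; split => //.
  apply: (neg' (mu / kap)) => [j jn|]; last by rewrite divr_gt0.
  exact: scale.
exists (h, g); rewrite ?inE ?eqxx ?orbT //= E /=; split => //.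
apply: (neg' (- mu / kap)) => [j jn|]; last by rewrite divr_gt0 // oppr_gt0.
by rewrite aE // /normal /=; field; rewrite gt_eqF.
Qed.

(** In the surviving plane [a] vanishes at [f], hence is [kap] times the rotated reduced row of [f].
    A negative [kap] is absorbed by exchanging the two columns, and [kap = 0] would make [a]
    zero. *)
Lemma wrap_normal us (i f : nat) (a v : nat -> R) :
  (0 < n)%N -> size us = n.-1 -> independent us ->
  {in us, forall u, gdot n (gen s u) a = 0} -> gvalid s i a ->
  is_gen s i f -> gdot n (gen s f) a = 0 ->
  (exists2 c, {in us, forall u, gdot n (gen s u) c = 0} & gdot n (gen s f) c != 0) ->
  gdot n v a < 0 ->
  let H := foldl (elim_row n) (gen s) us in
  let: (g, h) := last_two n (fun b => H (m + b)%N b != 0) in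
  exists2 gh, gh \in [:: (g, h); (h, g)] &
    let w := gift_wrap (H^~ gh.1) (H^~ gh.2) (gens s i) in
    w.2 = 0%N /\ gdot n v (normal m H gh.1 gh.2 w.1) < 0.
Proof.
move=> n0 sz ind aus va gf fa [c cus cf] neg H.
have := elim_plane n0 sz ind; rewrite -/H; cbv zeta; case: (last_two n _) => g h [gn hn plane].
have f0 : (H f g != 0) || (H f h != 0).
  apply: contraNT cf; rewrite negb_or !negbK => /andP[/eqP z1 /eqP z2].
  by rewrite plane // z1 z2 !mul0r addr0.
have aj j : (j < n.+1)%N -> a j = H (m + j)%N g * a g + H (m + j)%N h * a h.
  by move=> jn; rewrite -plane // gdot_unit.
have [|kap [hE gE]] := collinear f0 (p := a h) (q := - a g).
  by move: fa; rewrite plane // mulrN => fa; rewrite -opprD fa oppr0.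
have {}gE : a g = - (kap * H f h) by rewrite -gE opprK.
have [kap0|kap0|kap0] := ltgtP 0 kap.
- apply: (wrap_normal_pos gn hn) va kap0 gf f0 neg => j jn.
  by rewrite aj // hE gE -/H; ring.
- rewrite orbC in f0; have nkap : 0 < - kap by rewrite oppr_gt0.
  have [|gh ghP w] := wrap_normal_pos (us := us) hn gn _ va nkap gf f0 neg.
    by move=> j jn; rewrite aj // hE gE -/H; ring.
  by exists gh => //; move: ghP; rewrite !inE orbC.
- move: neg; rewrite /gdot big1 ?ltxx // => j _.
  by rewrite aj // hE gE -kap0 !mul0r oppr0 !mulr0 addr0 mulr0.
Qed.
End Elim.

(** * Enumeration of the ridges *)

Section Digits.
Local Open Scope nat_scope.

Definition digit (m t l : nat) : nat := (t %/ m ^ l) %% m.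

Definition digits_sorted (m k t : nat) : bool := path leq 0 (mkseq (digit m t) k).

Lemma digit0 m a t : a < m -> digit m (a + m * t) 0 = a.
Proof. by move=> am; rewrite /digit expn0 divn1 addnC mulnC modnMDl modn_small. Qed.

Lemma digitS m a t l : a < m -> digit m (a + m * t) l.+1 = digit m t l.
Proof.
move=> am; rewrite /digit expnS divnMA; congr (_ %/ _ %% _).
by rewrite addnC [m * t]mulnC divnMDl ?divn_small ?addn0 //; case: m am.
Qed.

Lemma digit_surj m k (d : nat -> nat) : (forall l, l < k -> d l < m) ->
  exists2 t, t < m ^ k & forall l, l < k -> digit m t l = d l.
Proof.
elim: k d => [|k IH] d dm; first by exists 0.
have [t tm td] := IH (fun l => d l.+1) (fun l lk => dm l.+1 lk).
have d0 := dm 0 isT; exists (d 0 + m * t).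
  rewrite expnS; apply: (@leq_trans (m * t.+1)); last by rewrite leq_mul2l tm orbT.
  by rewrite mulnS ltn_add2r.
by case=> [|l] lk; rewrite ?digit0 // digitS // td.
Qed.

Lemma digit_inj m k t t' : t < m ^ k -> t' < m ^ k ->
  (forall l, l < k -> digit m t l = digit m t' l) -> t = t'.
Proof.
elim: k t t' => [|k IH] t t'; first by rewrite expn0 !ltnS !leqn0 => /eqP-> /eqP->.
rewrite expnS => tm tm' E; have m0 : 0 < m by case: m tm {tm' E IH}.
have h0 : t %% m = t' %% m by have := E 0 isT; rewrite /digit expn0 !divn1.
rewrite (divn_eq t m) (divn_eq t' m) h0 (IH (t %/ m) (t' %/ m)) //.
- by rewrite ltn_divLR // mulnC.
- by rewrite ltn_divLR // mulnC.
- by move=> l lk; have := E l.+1 lk; rewrite /digit expnS !divnMA.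
Qed.

Lemma digit_lt m t l : 0 < m -> digit m t l < m.
Proof. exact: ltn_pmod. Qed.

(** Nondecreasing sequences are multisets, counted by a binomial coefficient. *)
Lemma digits_sorted_count m k : 0 < m ->
  count (digits_sorted m k) (iota 0 (m ^ k)) <= 'C(m.-1 + k, k).
Proof.
case: m => // m _.
pose f t : k.-tuple 'I_m.+1 := [tuple inord (digit m.+1 t l) | l < k].
have fE t : map val (f t) = mkseq (digit m.+1 t) k.
  rewrite /mkseq -val_enum_ord -!map_comp; apply: eq_map => l /=.
  by rewrite inordK // digit_lt.
have finj : {in filter (digits_sorted m.+1 k) (iota 0 (m.+1 ^ k)) &, injective f}.
  move=> t t'; rewrite !mem_filter !mem_iota /= !add0n => /andP[_ tk] /andP[_ tk'] E.
  apply: (digit_inj tk tk') => l lk.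
  have /(congr1 (fun r => nth 0 r l)) : mkseq (digit m.+1 t) k = mkseq (digit m.+1 t') k.
    by rewrite -!fE E.
  by rewrite !nth_mkseq.
rewrite -size_filter -(size_map f) addnC -card_sorted_tuples cardE.
apply: uniq_leq_size; first by rewrite map_inj_in_uniq ?filter_uniq ?iota_uniq.
move=> _ /mapP[t + ->]; rewrite mem_filter mem_enum inE fE /digits_sorted => /andP[+ _].
by case: (mkseq _ _) => //= a l /andP[].
Qed.

(** Passing from k to k + 1 amounts to 2 (m + k) <= (k + 2) m, true for m > 1. The binomial bound
    used here attains equality at m = 2, whence the factor k + 1. *)
Lemma sorted_count_bound m k : 1 < m ->
  count (digits_sorted m k) (iota 0 (m ^ k)) * 2 ^ k <= k.+1 * m ^ k.
Proof.
move=> m1; have m0 := ltnW m1.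
apply: leq_trans (leq_mul (digits_sorted_count k m0) (leqnn _)) _.
case: m m1 {m0} => [//|m] m1; elim: k => [|k IH]; first by rewrite bin0.
have E : (m + k).+1 * 'C(m + k, k) = k.+1 * 'C(m + k.+1, k.+1).
  by rewrite addnS; exact: mul_bin_diag.
rewrite -(leq_pmul2l (ltn0Sn k)) mulnA -E !expnS.
have -> : (m + k).+1 * 'C(m + k, k) * (2 * 2 ^ k) =
  (m + k).+1 * 2 * ('C(m + k, k) * 2 ^ k) by lia.
apply: leq_trans (leq_mul (leqnn _) IH) _.
have -> : k.+1 * (k.+2 * (m.+1 * m.+1 ^ k)) = k.+2 * m.+1 * (k.+1 * m.+1 ^ k) by lia.
by rewrite leq_mul2r; apply/orP; right; nia.
Qed.
End Digits.

Lemma separating_ridge (R : realType) (n : nat) (s : seq 'rV[R]_n) (x : 'rV[R]_n) :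
  (0 < n)%N -> (1 < size s)%N -> uniq s ->
  ~ Fmin (conv_hull [set x : 'rV[R]_n | x \in s]) x ->
  exists i t, [/\ (i < n)%N, (t < size s ^ n.-1)%N, digits_sorted (size s) n.-1 t &
    let us := mkseq (fun l => bump (size s + i) (digit (size s) t l + l)) n.-1 in
    let H := foldl (elim_row n) (gen s) us in
    let: (g, h) := last_two n (fun b => H (size s + b)%N b != 0) in
    exists2 gh, gh \in [:: (g, h); (h, g)] &
      let w := gift_wrap (H^~ gh.1) (H^~ gh.2) (gens s i) in
      w.2 = 0%N /\ gdot n (homog x) (normal (size s) H gh.1 gh.2 w.1) < 0].
Proof.
move=> n0 s1 us xF.
have [i [a [ks [ni va ax [ksn kss ksM] ksP]]]] := facet_separation n0 s1 us xF.
set m := size s in s1 ksM ksP *.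
have inks l : (l < n)%N -> nth 0%N ks l \in ks by move=> ln; rewrite mem_nth ?ksn.
have gap e l : (l + e < n)%N -> (nth 0 ks l + e <= nth 0 ks (l + e))%N.
  elim: e => [|e IH] le; first by rewrite !addn0.
  rewrite !addnS; apply: leq_ltn_trans (IH _) _; first by rewrite addnS in le; exact: ltnW.
  by apply: (sorted_ltn_nth ltn_trans 0%N kss); rewrite ?inE ?ksn; lia.
(* Subtracting l turns a strictly increasing sequence into a nondecreasing one. *)
pose d l := (nth 0 ks l - l)%N.
have dE l : (l < n)%N -> (d l + l = nth 0 ks l)%N.
  by move=> ln; have := gap l 0; rewrite add0n => /(_ ln); rewrite /d; lia.
(* All indices are below m + n - 1, and n - 1 - l of them lie above the l-th. *)
have dm l : (l < n.-1)%N -> (d l < m)%N.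
  move=> ln; have := gap (n.-1 - l)%N l; rewrite subnKC ?(ltnW ln) // prednK // => /(_ (leqnn _)).
  by have := ksM _ (inks n.-1 _); rewrite /d; lia.
have [t tm td] := digit_surj dm.
exists i, t; split => //.
  rewrite /digits_sorted; have -> : mkseq (digit m t) n.-1 = mkseq d n.-1.
    by apply/eq_in_map => l; rewrite mem_iota => /td.
  apply/(pathP 0%N) => l; rewrite size_mkseq => ln; rewrite nth_mkseq //.
  case: l ln => [//|l] ln /=; rewrite nth_mkseq; last exact: ltnW.
  by have := gap 1 l; rewrite addn1; have := dE l; have := dE l.+1; lia.
move=> us' H; set us0 := us' in H *.
have usE l : (l < n.-1)%N -> nth 0%N us0 l = bump (m + i) (nth 0%N ks l).
  by move=> ln; rewrite /us0 /us' nth_mkseq // td // dE //; lia.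
have szus : size us0 = n.-1 by rewrite size_mkseq.
have usP u : u \in us0 -> exists2 l, (l < n.-1)%N & u = bump (m + i) (nth 0%N ks l).
  by move=> uu; exists (index u us0); rewrite -?usE ?nth_index // -szus index_mem.
have uks : uniq ks by apply: sorted_uniq kss; [exact: ltn_trans | exact: ltnn].
apply: (@wrap_normal _ _ _ us0 i (bump (m + i) (nth 0%N ks n.-1)) a) => //.
- move=> l; rewrite szus => ln.
  have [|_ [c cP]] := ksP (nth 0%N ks l); first by apply: inks; lia.
  exists c.
    move=> u /(nthP 0%N)[j]; rewrite size_take szus ln => jl; rewrite nth_take // => <-.
    rewrite usE ?cP ?inks ?nth_uniq ?ksn //; try lia.
    by rewrite gtn_eqF.
  by rewrite usE // cP ?eqxx ?oner_eq0 // inks; lia.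
- move=> u /usP[l ln ->]; have [|-> //] := ksP (nth 0%N ks l); first by apply: inks; lia.
- by apply: is_gen_bump => //; rewrite ksM // inks; lia.
- by have [|-> //] := ksP (nth 0%N ks n.-1); rewrite inks //; lia.
- have [|_ [c cP]] := ksP (nth 0%N ks n.-1); first by apply: inks; lia.
  exists c => [u /usP[l ln ->]|].
    by rewrite cP ?inks ?nth_uniq ?ksn //; try lia; rewrite gtn_eqF.
  by rewrite cP ?eqxx ?oner_eq0 // inks; lia.
Qed.

(** * Hoare logic with running times *)

Fixpoint nat_writes (p : cmd) : seq nat :=
  match p with
  | NStore a _ _ => [:: a]
  | Seq p q | If _ p q => nat_writes p ++ nat_writes q
  | While _ p => nat_writes p
  | _ => [::]
  end.

Fixpoint real_writes (p : cmd) : seq nat :=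
  match p with
  | RStore a _ _ _ => [:: a]
  | Seq p q | If _ p q => real_writes p ++ real_writes q
  | While _ p => real_writes p
  | _ => [::]
  end.

Fixpoint silent (p : cmd) : bool :=
  match p with
  | Term _ _ | Close _ _ => false
  | Seq p q | If _ p q => silent p && silent q
  | While _ p => silent p
  | _ => true
  end.

Fixpoint loop_free (p : cmd) : bool :=
  match p with
  | Seq p q | If _ p q => loop_free p && loop_free q
  | While _ p => false
  | _ => true
  end.

Fixpoint straight_cost (p : cmd) : nat :=
  match p with
  | Skip => 1
  | NStore _ i e => (ncost i + ncost e).+1
  | RStore _ i j e => (ncost i + ncost j + rcost e).+1
  | Term j e => (ncost j + rcost e).+1
  | Close _ e => (rcost e).+1
  | Seq p q => straight_cost p + straight_cost q
  | If b p q => bcost b + maxn (straight_cost p) (straight_cost q)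
  | While _ _ => 0
  end.

Definition For (x : nat) (e : nexp) (c : cmd) : cmd :=
  Seq (NStore x (NConst 0) (NConst 0))
    (While (BNot (BLeN e (NLoad x (NConst 0))))
      (Seq c (NStore x (NConst 0) (NAdd (NLoad x (NConst 0)) (NConst 1))))).

Section Hoare.
Variable R : realType.
Implicit Types (st : state R) (Q : state R -> Prop).

Definition nat_set st a v : state R :=
  State (nupd (nmem st) a 0 v) (rmem st) (pending st) (output st).

(** Symbolic execution, which reduces the correctness of loop-free code to computation. The value on
    [While] is a dummy, excluded by [loop_free]. *)
Fixpoint straight (p : cmd) st : state R :=
  match p with
  | NStore a i e => State (nupd (nmem st) a (neval st i) (neval st e))
             (rmem st) (pending st) (output st)
  | RStore a i j e => State (nmem st)
             (rupd (rmem st) a (neval st i) (neval st j) (reval st e))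
             (pending st) (output st)
  | Term j e => State (nmem st) (rmem st)
             ((neval st j, reval st e) :: pending st) (output st)
  | Close is_eq e => State (nmem st) (rmem st) [::]
             ((pending st, is_eq, reval st e) :: output st)
  | Seq p q => straight q (straight p st)
  | If b p q => if beval st b then straight p st else straight q st
  | _ => st
  end.

(** Arrays are framed as a whole by name, so that preservation is decided by computing the lists of
    written names. *)
Definition frame (p : cmd) st st' : Prop :=
  [/\ forall a, a \notin nat_writes p -> nmem st' a = nmem st a,
      forall a, a \notin real_writes p -> rmem st' a = rmem st a &
      silent p -> pending st' = pending st /\ output st' = output st].

Definition runs (p : cmd) st (T : nat) Q : Prop :=
  exists t st', [/\ exec p st t st', (t <= T)%N & Q st'].

Lemma frame_trans p st1 st2 st3 : frame p st1 st2 -> frame p st2 st3 -> frame p st1 st3.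
Proof.
move=> [n1 r1 o1] [n2 r2 o2]; split=> [a h|a h|h]; first by rewrite n2 // n1.
  by rewrite r2 // r1.
by have [-> ->] := o2 h; exact: o1.
Qed.

Lemma frame_sub p q st st' :
  {subset nat_writes p <= nat_writes q} -> {subset real_writes p <= real_writes q} ->
  (silent q -> silent p) -> frame p st st' -> frame q st st'.
Proof.
move=> sn sr so [n1 r1 o1]; split=> [a h|a h|h]; last exact: o1 (so h).
  by apply: n1; apply: contraNN h; exact: sn.
by apply: r1; apply: contraNN h; exact: sr.
Qed.

Lemma exec_frame p st t st' : exec p st t st' -> frame p st st'.
Proof.
elim=> {p st t st'} //.
- move=> st a i e; split=> //= b; rewrite inE => /negPf ba.
  by rewrite funeqE => j; rewrite /nupd ba.
- move=> st a i j e; split=> //= b; rewrite inE => /negPf ba.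
  by rewrite funeqE => k; rewrite funeqE => l; rewrite /rupd ba.
- move=> p q st1 st2 st3 t1 t2 _ F1 _ F2; apply: (@frame_trans _ _ st2).
    by apply: frame_sub F1 => [a|a|/=/andP[]//]; rewrite /= mem_cat => ->.
  by apply: frame_sub F2 => [a|a|/=/andP[]//]; rewrite /= mem_cat => ->; rewrite orbT.
- move=> b p q st t st' _ _ F.
  by apply: frame_sub F => [a|a|/=/andP[]//]; rewrite /= mem_cat => ->.
- move=> b p q st t st' _ _ F.
  by apply: frame_sub F => [a|a|/=/andP[]//]; rewrite /= mem_cat => ->; rewrite orbT.
- by move=> b p st1 st2 st3 t1 t2 _ _ F1 _ F2; apply: frame_trans F2.
Qed.

Lemma runs_weaken p st T T' Q Q' : (T <= T')%N ->
  runs p st T Q -> (forall st', frame p st st' -> Q st' -> Q' st') -> runs p st T' Q'.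
Proof.
move=> TT [t [st' [E tT q]]] h; exists t, st'; split => //; first exact: leq_trans TT.
by apply: h => //; exact: exec_frame E.
Qed.

Lemma runs_straight p st T Q : loop_free p -> (straight_cost p <= T)%N ->
  Q (straight p st) -> runs p st T Q.
Proof.
move=> lf cT q.
suff [t [E tc]] : exists t, exec p st t (straight p st) /\ (t <= straight_cost p)%N.
  by exists t, (straight p st); split => //; exact: leq_trans cT.
elim: p st lf {T Q cT q} => //=; try by move=> *; eexists; split; [constructor | ].
- move=> p IHp q IHq st /andP[lp lq].
  have [t1 [E1 c1]] := IHp st lp; have [t2 [E2 c2]] := IHq (straight p st) lq.
  by exists (t1 + t2)%N; split; [exact: ExecSeq E1 E2 | exact: leq_add].
- move=> b p IHp q IHq st /andP[lp lq]; case: ifP => [bt|/negbT bf].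
    have [t [E c]] := IHp st lp; exists (bcost b + t)%N; split; first exact: ExecIfTrue.
    by rewrite leq_add2l leq_max c.
  have [t [E c]] := IHq st lq; exists (bcost b + t)%N; split; first exact: ExecIfFalse.
  by rewrite leq_add2l leq_max c orbT.
Qed.

Lemma runs_seq p q st T1 T2 T Q :
  runs p st T1 (fun st1 => frame p st st1 -> runs q st1 T2 Q) -> (T1 + T2 <= T)%N ->
  runs (Seq p q) st T Q.
Proof.
move=> [t1 [st1 [E1 c1 h]]] TT.
have [t2 [st2 [E2 c2 q2]]] := h (exec_frame E1).
exists (t1 + t2)%N, st2; split => //; first exact: ExecSeq E1 E2.
by apply: leq_trans TT; exact: leq_add.
Qed.

Lemma runs_if b p q st T1 T Q :
  (beval st b -> runs p st T1 Q) -> (~~ beval st b -> runs q st T1 Q) ->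
  (bcost b + T1 <= T)%N -> runs (If b p q) st T Q.
Proof.
move=> hp hq TT; have [bt|bf] := boolP (beval st b).
  have [t [st' [E c q']]] := hp bt; exists (bcost b + t)%N, st'; split => //.
    exact: ExecIfTrue.
  by apply: leq_trans TT; rewrite leq_add2l.
have [t [st' [E c q']]] := hq bf; exists (bcost b + t)%N, st'; split => //.
  exact: ExecIfFalse.
by apply: leq_trans TT; rewrite leq_add2l.
Qed.

(** The bound [e] is evaluated again at each test, so it must stay [N] along the loop. Besides [e],
    a round costs 4 for the test and 6 for the increment; 3 for the initialisation and 4 for the
    last test make the 7. [T] may vary with the round, which the amortisation over t requires. *)
Lemma runs_for x e c (N : nat) (T : nat -> nat) (I : nat -> state R -> Prop) st Tot Q :
  x \notin nat_writes c ->
  (forall st', frame (For x e c) st st' -> neval st' e = N) ->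
  (forall k st' v, I k st' -> I k (nat_set st' x v)) ->
  I 0%N st ->
  (forall k st', (k < N)%N -> nmem st' x 0%N = k -> frame (For x e c) st st' ->
     I k st' -> runs c st' (T k) (I k.+1)) ->
  (\sum_(0 <= k < N) (T k + (ncost e + 10)) + (ncost e + 7) <= Tot)%N ->
  (forall st', frame (For x e c) st st' -> I N st' -> Q st') ->
  runs (For x e c) st Tot Q.
Proof.
move=> xc eN Ix I0 step TT fin.
have subc st1 st2 : frame c st1 st2 -> frame (For x e c) st1 st2.
  apply: frame_sub => [a|a|] /=; last by rewrite andbT.
    by rewrite inE mem_cat => ->; rewrite orbT.
  by rewrite mem_cat => ->.
have setF st1 v : frame (For x e c) st1 (nat_set st1 x v).
  split => //= a; rewrite !inE mem_cat !negb_or => /andP[/negPf ax _].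
  by rewrite funeqE => i; rewrite /nupd ax.
pose body := Seq c (NStore x (NConst 0) (NAdd (NLoad x (NConst 0)) (NConst 1))).
pose guard := BNot (BLeN e (NLoad x (NConst 0))).
suff loop d k st1 : (k + d)%N = N -> nmem st1 x 0%N = k -> frame (For x e c) st st1 -> I k st1 ->
    exists t st', [/\ exec (While guard body) st1 t st',
      (t <= \sum_(k <= j < N) (T j + (ncost e + 10)) + (ncost e + 4))%N,
      frame (For x e c) st st' & I N st'].
  have [t [st' [E c1 F q]]] : exists t st', [/\ exec (While guard body) (nat_set st x 0) t st',
      (t <= \sum_(0 <= j < N) (T j + (ncost e + 10)) + (ncost e + 4))%N,
      frame (For x e c) st st' & I N st'].
    by apply: (loop N) => //=; [rewrite /nupd !eqxx | apply: Ix].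
  exists (3 + t)%N, st'; split; [|by lia|exact: fin].
  by apply: ExecSeq E; exact: ExecNStore.
elim: d k st1 => [|d IH] k st1 kN xk F Ik.
  exists (bcost guard), st1; rewrite addn0 in kN; split => //.
  - by apply: ExecWhileFalse; rewrite /= xk (eN _ F) kN leqnn.
  - by rewrite /= kN big_geq //; lia.
  - by rewrite -kN.
have kN' : (k < N)%N by lia.
have [t1 [st2 [E1 c1 I2]]] := step k st1 kN' xk F Ik.
have F2 := exec_frame E1.
have xk2 : nmem st2 x 0%N = k by have [-> // _ _] := F2.
pose st3 := nat_set st2 x k.+1.
have [|||t [st' [E2 c2 F3 q]]] := IH k.+1 st3 (etrans (addSnnS _ _) kN).
- by rewrite /= /nupd !eqxx.
- apply: frame_trans F _; apply: frame_trans (subc _ _ F2) _; exact: setF.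
- exact: Ix.
exists (bcost guard + (t1 + 6) + t)%N, st'; split => //.
- apply: ExecWhileTrue E2; first by rewrite /= xk (eN _ F) -ltnNge.
  apply: ExecSeq E1 _; rewrite /st3 /nat_set -[k.+1]addn1 -[in X in nupd _ _ _ X]xk2.
  exact: (@ExecNStore R st2 x (NConst 0) (NAdd (NLoad x (NConst 0)) (NConst 1))).
- by rewrite [X in (_ <= X + _)%N]big_ltn //= ; lia.
Qed.

Lemma runs_for_const x e c (N T : nat) (I : nat -> state R -> Prop) st Tot Q :
  x \notin nat_writes c ->
  (forall st', frame (For x e c) st st' -> neval st' e = N) ->
  (forall k st' v, I k st' -> I k (nat_set st' x v)) ->
  I 0%N st ->
  (forall k st', (k < N)%N -> nmem st' x 0%N = k -> frame (For x e c) st st' ->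
     I k st' -> runs c st' T (I k.+1)) ->
  (N * (T + (ncost e + 10)) + (ncost e + 7) <= Tot)%N ->
  (forall st', frame (For x e c) st st' -> I N st' -> Q st') ->
  runs (For x e c) st Tot Q.
Proof.
move=> xc eN Ix I0 step TT; apply: (runs_for (T := fun=> T) (N := N)) I0 step _ => //.
by rewrite sum_nat_const_nat subn0.
Qed.
End Hoare.

(** * The program and its verification *)

Notation NVar a := (NLoad a (NConst 0)).
Notation RVar a := (RLoad a (NConst 0) (NConst 0)).
Notation NSet a e := (NStore a (NConst 0) e).
Notation RSet a e := (RStore a (NConst 0) (NConst 0) e).
Notation dim := (NLoad 0 (NConst 0)).
Notation npts := (NLoad 0 (NConst 1)).
Notation dim1 := (NAdd dim (NConst 1)).
Notation nrows := (NAdd npts dim1).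
Notation BLtN a b := (BNot (BLeN b a)).
Notation BEqN a b := (BAnd (BLeN a b) (BLeN b a)).
Notation BIsZero e := (BAnd (BLeR e RZero) (BLeR RZero e)).

(* Integer variables: 1 digits, 2 digit counter, 3-5, 12, 13 loop counters,
   6 coordinate i, 7 eliminated row, 8 pivot, 9-10 coordinates of the plane,
   11 flag, 14 sortedness, 15 previous digit, 16 carry, 17 number of
   constraints, 18 target number, 19-21 scratch, 22 n * m.
   Real variables: 1 reduced rows, 2 pivot row, 3-4 current direction, 5 norm,
   6 number of constraints, 7 scratch. *)
Definition load_rows : cmd :=
  For 4 nrows (For 5 dim1
    (If (BLtN (NVar 4) npts)
      (If (BLtN (NVar 5) dim)
        (RStore 1 (NVar 4) (NVar 5) (RSub RZero (RLoad 0 (NVar 4) (NVar 5))))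
        (RStore 1 (NVar 4) (NVar 5) ROne))
      (If (BEqN (NVar 4) (NAdd npts (NVar 5)))
        (RStore 1 (NVar 4) (NVar 5) ROne)
        (RStore 1 (NVar 4) (NVar 5) RZero)))).

Definition find_pivot : cmd :=
  Seq (NSet 8 (NConst 0))
    (For 5 dim1 (If (BNot (BIsZero (RLoad 1 (NVar 7) (NVar 5))))
      (NSet 8 (NVar 5)) Skip)).

(** Saved in advance because the subtraction runs over all rows and overwrites row [u] too; likewise
    [subtract_row] saves the pivot entry of its row. *)
Definition save_pivot_row : cmd :=
  For 5 dim1 (RStore 2 (NConst 0) (NVar 5)
    (RDiv (RLoad 1 (NVar 7) (NVar 5)) (RLoad 1 (NVar 7) (NVar 8)))).

Definition subtract_row : cmd :=
  Seq (RSet 7 (RLoad 1 (NVar 4) (NVar 8)))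
    (For 5 dim1 (RStore 1 (NVar 4) (NVar 5)
      (RSub (RLoad 1 (NVar 4) (NVar 5))
        (RMul (RVar 7) (RLoad 2 (NConst 0) (NVar 5)))))).

Definition eliminate : cmd :=
  Seq find_pivot (Seq save_pivot_row (For 4 nrows subtract_row)).

Definition next_row : cmd :=
  Seq (NSet 7 (NAdd (NLoad 1 (NVar 3)) (NVar 3)))
    (If (BLeN (NAdd npts (NVar 6)) (NVar 7)) (NSet 7 (NAdd (NVar 7) (NConst 1))) Skip).

Definition eliminate_all : cmd :=
  For 3 (NSub dim (NConst 1)) (Seq next_row eliminate).

Definition find_plane : cmd :=
  Seq (Seq (NSet 9 (NConst 0)) (NSet 10 (NConst 0)))
    (For 5 dim1 (If (BNot (BIsZero (RLoad 1 (NAdd npts (NVar 5)) (NVar 5))))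
      (Seq (NSet 9 (NVar 10)) (NSet 10 (NVar 5))) Skip)).

Lemma iotaSr a k : iota a k.+1 = rcons (iota a k) (a + k)%N.
Proof. by rewrite -addn1 iotaD cats1. Qed.

Section Specs.
Variables (R : realType) (n : nat) (s : seq 'rV[R]_n).
Let m := size s.
Let L := n.+1.
Let M := (m + n.+1)%N.
Implicit Types (st : state R).

Definition input_intact st : Prop :=
  [/\ nmem st 0%N 0%N = n, nmem st 0%N 1%N = m &
      rmem st 0%N = fun k j => coord (nth 0 s k) j].

Lemma input_frame p st st' : frame p st st' -> input_intact st ->
  0%N \notin nat_writes p -> 0%N \notin real_writes p -> input_intact st'.
Proof. by move=> [fn fr _] [i1 i2 i3] hn hr; split; rewrite ?fn ?fr. Qed.

Definition rows_are (H : nat -> nat -> R) st : Prop :=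
  forall k b, (k < M)%N -> (b < L)%N -> rmem st 1%N k b = H k b.

Let reval0 (x : R) : (x <= 0) && (0 <= x) = (x == 0).
Proof. by rewrite eq_le. Qed.

Lemma runs_load_rows st : input_intact st ->
  runs load_rows st (100 * M * L) (rows_are (gen s)).
Proof.
move=> inp; pose cell k b st' := forall k' b', (k' < M)%N -> (b' < L)%N ->
  (k' < k)%N || ((k' == k) && (b' < b)%N) -> rmem st' 1%N k' b' = gen s k' b'.
apply: (runs_for_const (N := M) (T := (60 * L)%N) (I := fun k st' => cell k 0%N st')) => //.
- by move=> st' F; have [/= -> -> _] := input_frame F inp isT isT; rewrite addn1.
- by move=> k b _ _; rewrite !ltn0 andbF.
- move=> k st1 kM k1 F C1; have inp1 := input_frame F inp isT isT.
  apply: (runs_for_const (N := L) (T := 30) (I := fun b st' => nmem st' 4%N 0%N = k /\ cell k b st')) => //.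
  + by move=> st' F1; have [/= -> _ _] := input_frame F1 inp1 isT isT; rewrite addn1.
  + move=> b st2 bL b2 F2 [k2 C2]; have [n2 m2 r2] := input_frame F2 inp1 isT isT.
    apply: runs_straight => //.
    set q := If _ _ _.
    have -> : straight q st2 = State (nmem st2) (rupd (rmem st2) 1 k b (gen s k b))
        (pending st2) (output st2).
      rewrite /= k2 b2 n2 m2 -!ltnNge -eqn_leq /gen /homog -/m.
      case: ltnP => _; first by case: ltnP => _ //=; rewrite r2 sub0r.
      by case: eqP.
    split=> // k' b' kM' bL' h; rewrite /= /rupd /=.
    case: (k' =P k) h => [->|kk] /= h; last by apply: C2 => //; lia.
    by case: eqP => [->//|bb]; apply: C2 => //; lia.
  + by rewrite /= /L; lia.
  + by move=> st' _ [_ C] k' b' kM' bL' /orP[kk|/andP[_ //]]; apply: C => //; lia.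
- by rewrite /= /M /L; nia.
- by move=> st' _ C k b kM bL; apply: C; rewrite ?kM.
Qed.

Lemma rows_frame H p st st' : frame p st st' -> rows_are H st ->
  1%N \notin real_writes p -> rows_are H st'.
Proof. by move=> [_ fr _] h hr k b kM bL; rewrite fr // h. Qed.

Lemma nmem_frame p st st' a i v : frame p st st' -> nmem st a i = v ->
  a \notin nat_writes p -> nmem st' a i = v.
Proof. by move=> [fn _ _] h hn; rewrite fn. Qed.

Lemma runs_find_pivot H u st : input_intact st -> rows_are H st ->
  nmem st 7%N 0%N = u -> (u < M)%N ->
  runs find_pivot st (60 * L) (fun st' => nmem st' 8%N 0%N = pivot n (H u)).
Proof.
move=> inp rH u7 uM.
apply: (runs_seq (T1 := 3) (T2 := 57 * L)); last by rewrite /L; lia.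
apply: runs_straight => // F; have inp1 := input_frame F inp isT isT.
have rH1 := rows_frame F rH isT; have u71 := nmem_frame F u7 isT.
apply: (runs_for_const (N := L) (T := 30) (I := fun k st' =>
  nmem st' 8%N 0%N = foldl (fun p b => if H u b != 0 then b else p) 0%N (iota 0 k))) => //.
- by move=> st' F1; have [/= -> _ _] := input_frame F1 inp1 isT isT; rewrite addn1.
- move=> k st1 kL k1 F1 p1; apply: runs_straight => //.
  have rH2 := rows_frame F1 rH1 isT; have u72 := nmem_frame F1 u71 isT.
  rewrite iotaSr foldl_rcons add0n -p1 /= u72 k1 rH2 // reval0.
  by case: eqP => //= _; rewrite k1.
- by rewrite /= /L; lia.
Qed.

Lemma runs_save_pivot_row H u p st : input_intact st -> rows_are H st ->
  nmem st 7%N 0%N = u -> nmem st 8%N 0%N = p -> (u < M)%N -> (p < L)%N ->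
  runs save_pivot_row st (60 * L)
    (fun st' => forall b, (b < L)%N -> rmem st' 2%N 0%N b = H u b / H u p).
Proof.
move=> inp rH u7 p8 uM pL.
apply: (runs_for_const (N := L) (T := 30) (I := fun k st' => forall b, (b < k)%N ->
   rmem st' 2%N 0%N b = H u b / H u p)) => //.
- by move=> st' F1; have [/= -> _ _] := input_frame F1 inp isT isT; rewrite addn1.
- move=> k st1 kL k1 F1 I1; apply: runs_straight => // b bk.
  have rH1 := rows_frame F1 rH isT; have u71 := nmem_frame F1 u7 isT.
  have p81 := nmem_frame F1 p8 isT.
  rewrite /= /rupd /= k1 u71 p81 !rH1 //.
  by case: eqP => [->//|bk']; apply: I1; lia.
- by rewrite /= /L; lia.
Qed.

Lemma runs_subtract_rows H u p st : input_intact st -> rows_are H st ->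
  nmem st 8%N 0%N = p -> (p < L)%N ->
  (forall b, (b < L)%N -> rmem st 2%N 0%N b = H u b / H u p) ->
  runs (For 4 nrows subtract_row) st (100 * M * L)
    (rows_are (fun k b => H k b - H k p * (H u b / H u p))).
Proof.
move=> inp rH p8 pL F2; set E := fun k b : nat => _.
pose done k b st' := forall k' b', (k' < M)%N -> (b' < L)%N -> rmem st' 1%N k' b' =
  if (k' < k)%N || ((k' == k) && (b' < b)%N) then E k' b' else H k' b'.
apply: (runs_for_const (N := M) (T := (65 * L)%N) (I := fun k st' => done k 0%N st')) => //.
- by move=> st' F1; have [/= -> -> _] := input_frame F1 inp isT isT; rewrite addn1.
- by move=> k b kM bL; rewrite !ltn0 andbF rH.
- move=> k st1 kM k1 F1 D1.
  have inp1 := input_frame F1 inp isT isT; have p81 := nmem_frame F1 p8 isT.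
  have [_ fr1 _] := F1.
  apply: (runs_seq (T1 := 8) (T2 := 57 * L)); last by rewrite /L; lia.
  apply: runs_straight => //; set st2 := straight _ _ => Fs.
  have inp2 := input_frame Fs inp1 isT isT; have k2 := nmem_frame Fs k1 isT.
  have h7 : rmem st2 7%N 0%N 0%N = H k p.
    by rewrite /st2 /= /rupd /= k1 p81 D1 // ltnn andbF.
  apply: (runs_for_const (N := L) (T := 30) (I := fun b st' => done k b st')) => //.
  + by move=> st' F'; have [/= -> _ _] := input_frame F' inp2 isT isT; rewrite addn1.
  + move=> b st3 bL b3 F3 D3; apply: runs_straight => // k' b' kM' bL'.
    have k3 := nmem_frame F3 k2 isT; have [_ fr3 _] := F3; have [_ frs _] := Fs.
    rewrite /= /rupd /= k3 b3 (fr3 7%N) // h7 (fr3 2%N) // (frs 2%N) // (fr1 2%N) // F2 //.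
    case: (k' =P k) => [->|kk] /=.
      case: (b' =P b) => [->|bb].
        by rewrite D3 // !ltnn eqxx /= leqnn.
      by rewrite D3 // eqxx /= !ltnn /=; congr (if _ then _ else _); lia.
    by rewrite D3 //; case: eqP => // _ /=; rewrite !orbF.
  + by rewrite /= /L; lia.
  + move=> st' _ D k' b' kM' bL'; rewrite D // bL' andbT ltn0 andbF orbF ltnS.
    by rewrite [in RHS]leq_eqVlt orbC.
- by rewrite /= /M /L; nia.
- by move=> st' _ D k b kM bL; rewrite D // kM.
Qed.

Lemma runs_eliminate H u st : input_intact st -> rows_are H st ->
  nmem st 7%N 0%N = u -> (u < M)%N ->
  runs eliminate st (220 * M * L) (rows_are (elim_row n H u)).
Proof.
move=> inp rH u7 uM; have [pL _] := pivotP n (H u).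
apply: (runs_seq (T1 := 60 * L) (T2 := 160 * M * L)); last by rewrite /M /L; nia.
apply: runs_weaken (runs_find_pivot inp rH u7 uM) _ => // st1 _ p8 F1.
have inp1 := input_frame F1 inp isT isT; have rH1 := rows_frame F1 rH isT.
have u71 := nmem_frame F1 u7 isT.
apply: (runs_seq (T1 := 60 * L) (T2 := 100 * M * L)); last by rewrite /M /L; nia.
apply: runs_weaken (runs_save_pivot_row inp1 rH1 u71 p8 uM pL) _ => // st2 _ E2 F2.
have p82 := nmem_frame F2 p8 isT.
exact: runs_subtract_rows (input_frame F2 inp1 isT isT) (rows_frame F2 rH1 isT) p82 pL E2.
Qed.

Lemma runs_eliminate_all (d : nat -> nat) i st : input_intact st -> rows_are (gen s) st ->
  (forall l, (l < n.-1)%N -> nmem st 1%N l = d l /\ (d l < m)%N) ->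
  nmem st 6%N 0%N = i -> (0 < n)%N ->
  runs eliminate_all st (300 * M * L * L) (rows_are
    (foldl (elim_row n) (gen s) (mkseq (fun l => bump (m + i) (d l + l)) n.-1))).
Proof.
move=> inp rH dd i6 n0.
apply: (runs_for_const (N := n.-1) (T := (260 * M * L)%N) (I := fun l st' => rows_are
  (foldl (elim_row n) (gen s) (mkseq (fun l => bump (m + i) (d l + l)) l)) st')) => //.
- by move=> st' F1; have [/= -> _ _] := input_frame F1 inp isT isT; rewrite subn1.
- move=> l st1 ln l1 F1 r1; have inp1 := input_frame F1 inp isT isT.
  have [n1 m1 _] := inp1; have i61 := nmem_frame F1 i6 isT.
  have [dl dm] := dd l ln; have dl1 := nmem_frame F1 dl isT.
  apply: (runs_seq (T1 := 40) (T2 := 220 * M * L)); last by rewrite /M /L; nia.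
  apply: runs_straight => //; set st2 := straight _ _ => F2.
  have u7 : nmem st2 7%N 0%N = bump (m + i) (d l + l).
    rewrite /st2 /= /nupd /= l1 dl1 m1 i61 /bump.
    by case: ifP => _ /=; rewrite /nupd /= ?l1 ?dl1 //; lia.
  rewrite mkseqS foldl_rcons.
  apply: runs_eliminate => //; [exact: input_frame F2 inp1 isT isT | exact: rows_frame F2 r1 isT | ].
  by rewrite /bump /M; case: leqP; lia.
- rewrite /= /M /L; case: (n) n0 => // n' _ /=; nia.
Qed.

Lemma runs_find_plane H st : input_intact st -> rows_are H st ->
  runs find_plane st (100 * L) (fun st' => (nmem st' 9%N 0%N, nmem st' 10%N 0%N) =
    last_two n (fun b => H (m + b)%N b != 0)).
Proof.
move=> inp rH.
apply: (runs_seq (T1 := 6) (T2 := 90 * L)); last by rewrite /L; lia.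
apply: runs_straight => // F; have inp1 := input_frame F inp isT isT.
have rH1 := rows_frame F rH isT.
apply: (runs_for_const (N := L) (T := 40) (I := fun k st' =>
  (nmem st' 9%N 0%N, nmem st' 10%N 0%N) =
  foldl (fun gh b => if H (m + b)%N b != 0 then (gh.2, b) else gh) (0, 0)%N (iota 0 k))) => //.
- by move=> st' F1; have [/= -> _ _] := input_frame F1 inp1 isT isT; rewrite addn1.
- move=> k st1 kL k1 F1 p1; apply: runs_straight => //.
  have rH2 := rows_frame F1 rH1 isT; have [_ m1 _] := input_frame F1 inp1 isT isT.
  rewrite iotaSr foldl_rcons add0n -p1 /= m1 k1 rH2 ?ltn_add2l // reval0.
  by case: eqP => //= _; rewrite /nupd /= k1.
- by rewrite /= /L; lia.
Qed.
End Specs.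

(** * Machine code for gift wrapping and for writing constraints *)

Definition wrap_body : cmd :=
  If (BEqN (NVar 4) (NAdd npts (NVar 6))) Skip
    (If (BAnd (BNot (BAnd (BIsZero (RVar 3)) (BIsZero (RVar 4))))
          (BLeR RZero (RSub (RMul (RVar 3) (RLoad 1 (NVar 4) (NVar 10)))
                            (RMul (RVar 4) (RLoad 1 (NVar 4) (NVar 9))))))
      Skip
      (Seq (RSet 3 (RLoad 1 (NVar 4) (NVar 9)))
        (Seq (RSet 4 (RLoad 1 (NVar 4) (NVar 10))) (NSet 11 (NConst 1))))).

Definition wrap_plane : cmd :=
  Seq (Seq (RSet 3 RZero) (Seq (RSet 4 RZero) (NSet 11 (NConst 0))))
    (For 12 (NConst 3) (Seq (NSet 11 (NConst 0)) (For 4 (NAdd npts dim) wrap_body))).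

Notation normal_entry j :=
  (RSub (RMul (RVar 3) (RLoad 1 (NAdd npts j) (NVar 10)))
        (RMul (RVar 4) (RLoad 1 (NAdd npts j) (NVar 9)))).

Definition normal_norm : cmd :=
  Seq (RSet 5 RZero)
    (For 13 dim (If (BLeR RZero (normal_entry (NVar 13)))
      (RSet 5 (RAdd (RVar 5) (normal_entry (NVar 13))))
      (RSet 5 (RSub (RVar 5) (normal_entry (NVar 13)))))).

(** The count is kept twice, as a real to scale by and as an integer to pad by, since the machine
    does not convert between the two. *)
Definition count_constraint : cmd :=
  Seq (RSet 6 (RAdd (RVar 6) ROne)) (NSet 17 (NAdd (NVar 17) (NConst 1))).

Definition emit_terms : cmd :=
  For 13 dim (Term (NVar 13) (RDiv (RMul (normal_entry (NVar 13)) (RVar 6)) (RVar 5))).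

(** A normal with zero coefficients cannot be scaled to a prescribed norm; it is dropped, and cuts
    off no point if it is valid. *)
Definition emit : cmd :=
  If (BAnd (BLeN (NVar 11) (NConst 0)) (BNot (BLeR (RVar 5) RZero)))
    (Seq count_constraint (Seq emit_terms
      (Close false (RDiv (RMul (normal_entry dim) (RVar 6)) (RVar 5)))))
    Skip.

Definition orientation : cmd := Seq wrap_plane (Seq normal_norm emit).

Definition terms (R : realType) (f : nat -> R) (k : nat) : seq (nat * R) :=
  rev (mkseq (fun j => (j, f j)) k).

Section Specs.
Variables (R : realType) (n : nat) (s : seq 'rV[R]_n).
Let m := size s.
Let L := n.+1.
Let M := (m + n.+1)%N.
Implicit Types (st : state R).

Let reval0 (x : R) : (x <= 0) && (0 <= x) = (x == 0).
Proof. by rewrite eq_le. Qed.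

Lemma runs_wrap_pass H g h i c st : input_intact s st -> rows_are s H st ->
  nmem st 9%N 0%N = g -> nmem st 10%N 0%N = h -> nmem st 6%N 0%N = i ->
  (g < L)%N -> (h < L)%N -> nmem st 11%N 0%N = 0%N ->
  rmem st 3%N 0%N 0%N = c.1 -> rmem st 4%N 0%N 0%N = c.2 ->
  runs (For 4 (NAdd npts dim) wrap_body) st (200 * M) (fun st' =>
    (rmem st' 3%N 0%N 0%N, rmem st' 4%N 0%N 0%N, nmem st' 11%N 0%N) =
      wrap_pass (H^~ g) (H^~ h) (gens s i) c).
Proof.
move=> inp rH g9 h10 i6 gL hL f11 c3 c4.
apply: (runs_for_const (N := m + n) (T := 150) (I := fun k st' =>
  (rmem st' 3%N 0%N 0%N, rmem st' 4%N 0%N 0%N, nmem st' 11%N 0%N) =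
  wrap_pass (H^~ g) (H^~ h) [seq k <- iota 0 k | k != m + i]%N c)) => //.
- by move=> st' F1; have [/= -> -> _] := input_frame F1 inp isT isT.
- by rewrite c3 c4 f11; case: (c).
- move=> k st1 kM k1 F1 p1; apply: runs_straight => //.
  have rH1 := rows_frame F1 rH isT; have [_ m1 _] := input_frame F1 inp isT isT.
  have g1 := nmem_frame F1 g9 isT; have h1 := nmem_frame F1 h10 isT.
  have i1 := nmem_frame F1 i6 isT; have kM' : (k < M)%N by rewrite /M; lia.
  rewrite iotaSr add0n filter_rcons /= k1 m1 i1 -eqn_leq.
  case: eqP => [_|_] //=; rewrite /wrap_pass foldl_rcons -/(wrap_pass _ _ _ _) -p1.
  rewrite /wrap_step /= ?k1 g1 h1 !rH1 // !reval0 negb_and.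
  by case: ifP => //= _; rewrite /rupd /nupd /= ?k1 ?g1 ?h1 ?rH1.
- by rewrite /= /M; lia.
Qed.

Lemma runs_wrap_plane H g h i st : input_intact s st -> rows_are s H st ->
  nmem st 9%N 0%N = g -> nmem st 10%N 0%N = h -> nmem st 6%N 0%N = i ->
  (g < L)%N -> (h < L)%N ->
  runs wrap_plane st (700 * M) (fun st' =>
    (rmem st' 3%N 0%N 0%N, rmem st' 4%N 0%N 0%N, nmem st' 11%N 0%N) =
      gift_wrap (H^~ g) (H^~ h) (gens s i)).
Proof.
move=> inp rH g9 h10 i6 gL hL.
apply: (runs_seq (T1 := 20) (T2 := 680 * M)); last by rewrite /M; lia.
apply: runs_straight => //; set st1 := straight _ _ => F.
have inp1 := input_frame F inp isT isT; have rH1 := rows_frame F rH isT.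
have g1 := nmem_frame F g9 isT; have h1 := nmem_frame F h10 isT.
have i1 := nmem_frame F i6 isT.
apply: (runs_for_const (N := 3) (T := (203 * M)%N) (I := fun k st' =>
  (rmem st' 3%N 0%N 0%N, rmem st' 4%N 0%N 0%N, nmem st' 11%N 0%N) =
  iter k (fun z => wrap_pass (H^~ g) (H^~ h) (gens s i) z.1) ((0, 0), 0%N))) => //.
- move=> k st2 _ k2 F2 p2.
  apply: (runs_seq (T1 := 3) (T2 := 200 * M)); last by rewrite /M; lia.
  apply: runs_straight => //; set st3 := straight _ _ => F3.
  have inp3 := input_frame F3 (input_frame F2 inp1 isT isT) isT isT.
  have rH3 := rows_frame F3 (rows_frame F2 rH1 isT) isT.
  have g3 := nmem_frame F3 (nmem_frame F2 g1 isT) isT.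
  have h3 := nmem_frame F3 (nmem_frame F2 h1 isT) isT.
  have i3 := nmem_frame F3 (nmem_frame F2 i1 isT) isT.
  rewrite iterS -p2; exact: runs_wrap_pass.
- by rewrite /= /M; lia.
Qed.

Lemma runs_normal_norm H g h c st : input_intact s st -> rows_are s H st ->
  nmem st 9%N 0%N = g -> nmem st 10%N 0%N = h -> (g < L)%N -> (h < L)%N ->
  rmem st 3%N 0%N 0%N = c.1 -> rmem st 4%N 0%N 0%N = c.2 ->
  runs normal_norm st (150 * L) (fun st' =>
    rmem st' 5%N 0%N 0%N = \sum_(j < n) `|normal m H g h c j|).
Proof.
move=> inp rH g9 h10 gL hL c3 c4.
apply: (runs_seq (T1 := 4) (T2 := 146 * L)); last by rewrite /L; lia.
apply: runs_straight => // F; have inp1 := input_frame F inp isT isT.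
have rH1 := rows_frame F rH isT; have g1 := nmem_frame F g9 isT.
have h1 := nmem_frame F h10 isT; have [_ fr _] := F.
apply: (runs_for_const (N := n) (T := 100) (I := fun k st' =>
  rmem st' 5%N 0%N 0%N = \sum_(0 <= j < k) `|normal m H g h c j|)) => //.
- by move=> st' F1; have [/= -> _ _] := input_frame F1 inp1 isT isT.
- by rewrite big_nil.
- move=> k st2 kn k2 F2 p2; apply: runs_straight => //.
  have rH2 := rows_frame F2 rH1 isT; have [_ m2 _] := input_frame F2 inp1 isT isT.
  have g2 := nmem_frame F2 g1 isT; have h2 := nmem_frame F2 h1 isT.
  have [_ fr2 _] := F2.
  have kM : (m + k < M)%N by rewrite /M; lia.
  rewrite big_nat_recr //= -p2 k2 m2 g2 h2 (fr2 3%N) // (fr2 4%N) // (fr 3%N) // (fr 4%N) //.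
  rewrite !rH2 // c3 c4 /normal; set a := _ - _.
  have aE : a = normal m H g h c k by [].
  case: (lerP 0 a) => a0; rewrite /= /rupd /= ?k2 ?m2 ?g2 ?h2 ?(fr2 3%N) // ?(fr2 4%N) //
    ?(fr 3%N) // ?(fr 4%N) // ?rH2 // ?c3 ?c4 -/a.
    by rewrite ger0_norm.
  by rewrite ltr0_norm.
- by rewrite /= /L; lia.
- by move=> st' _ ->; rewrite big_mkord.
Qed.
End Specs.

(** * Invariants of the output *)

Section Log.
Variables (R : realType) (n : nat) (s : seq 'rV[R]_n).
Let m := size s.
Let L := n.+1.
Let M := (m + n.+1)%N.
Implicit Types (st : state R) (O : seq (sparse_con R)).

Lemma terms_sum (f : nat -> R) (j : nat) : (j < n)%N ->
  \sum_(t <- terms f n | t.1 == j) t.2 = f j.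
Proof.
move=> jn; rewrite /terms (perm_big (mkseq (fun j => (j, f j)) n)) ?perm_rev //=.
rewrite /mkseq big_map /= -big_filter.
rewrite (_ : filter _ _ = [:: j]) ?big_seq1 //.
rewrite -(@filter_pred1_uniq _ (iota 0 n) j) ?iota_uniq ?mem_iota //.
Qed.

Lemma terms_well_indexed (f : nat -> R) : all (fun t => t.1 < n)%N (terms f n).
Proof.
by apply/allP => t; rewrite mem_rev => /mapP[j + ->]; rewrite mem_iota.
Qed.

(* The q-th constraint has coefficients of l1 norm q, or is 0 <= q: hence no
   two constraints coincide. *)
Definition numbered (q : nat) (c : lincon R n) : Prop :=
  let r := \sum_j `|c.1.1 0 j| in r = q%:R \/ r = 0 /\ c.2 = q%:R.

Definition lawful (q : nat) (c : sparse_con R) : Prop :=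
  [/\ well_indexed n c, numbered q (decode n c) &
      forall x, Fmin (conv_hull [set x : 'rV[R]_n | x \in s]) x -> satisfies x (decode n c)].

(** The newest constraint comes first, so its number is the length of the tail plus 1. *)
Fixpoint lawful_all O : Prop :=
  if O is c :: O' then lawful (size O').+1 c /\ lawful_all O' else True.

Definition logged O st : Prop :=
  [/\ output st = O, pending st = [::], rmem st 6%N 0%N 0%N = (size O)%:R,
      nmem st 17%N 0%N = size O & lawful_all O].

Definition cuts O (x : 'rV[R]_n) : bool := has (fun c => ~~ satisfies x (decode n c)) O.

Lemma logged_frame p O st st' : frame p st st' -> logged O st ->
  [&& 17%N \notin nat_writes p, 6%N \notin real_writes p & silent p] -> logged O st'.
Proof.
move=> [fn fr fo] [o1 p1 r1 n1 l1] /and3P[h1 h2 h3].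
by have [E1 E2] := fo h3; split; rewrite ?E1 ?E2 ?fn ?fr.
Qed.

Lemma lawful_uniq O : lawful_all O -> uniq (map (decode n) O).
Proof.
have num q q' c : numbered q.+1 c -> numbered q'.+1 c -> q = q'.
  move=> h1 h2; apply/eqP; rewrite -eqSS -(eqr_nat R); apply/eqP.
  have z q0 : q0.+1%:R = 0 :> R -> False by move/eqP; rewrite pnatr_eq0.
  move: h1 h2; rewrite /numbered; set r := \sum_j _.
  move=> [rq|[r0 bq]] [rq'|[r0' bq']]; rewrite -?rq -?rq' -?bq -?bq' //.
    by case: (z q); rewrite -rq.
  by case: (z q'); rewrite -rq'.
have small q c O' : (size O' <= q)%N -> lawful_all O' -> numbered q.+1 c ->
    c \notin map (decode n) O'.
  elim: O' => //= c' O' IH sq [[_ nc' _] la] nc; rewrite inE negb_or IH ?(ltnW sq) // andbT.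
  by apply/eqP => E; move: sq; rewrite E in nc; rewrite -ltnS (num _ _ _ nc nc') ltnn.
elim: O => //= c O IH [[_ nc _] la]; rewrite IH // andbT.
exact: small nc.
Qed.

Section Emit.
Variables (H : nat -> nat -> R) (g h : nat) (c : R * R).
Let a := normal m H g h c.

Lemma runs_emit_terms q nrm st : input_intact s st -> rows_are s H st ->
  nmem st 9%N 0%N = g -> nmem st 10%N 0%N = h -> (g < L)%N -> (h < L)%N ->
  rmem st 3%N 0%N 0%N = c.1 -> rmem st 4%N 0%N 0%N = c.2 ->
  rmem st 5%N 0%N 0%N = nrm -> rmem st 6%N 0%N 0%N = q -> pending st = [::] ->
  runs emit_terms st (100 * L) (fun st' => output st' = output st /\
    pending st' = terms (fun j => a j * q / nrm) n).
Proof.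
move=> inp rH g9 h10 gL hL c3 c4 r5 r6 pd.
apply: (runs_for_const (N := n) (T := 60) (I := fun k st' => output st' = output st /\
    pending st' = terms (fun j => a j * q / nrm) k)) => //.
- by move=> st' F1; have [/= -> _ _] := input_frame F1 inp isT isT.
- move=> k st1 kn k1 F1 [o1 p1]; apply: runs_straight => //; split => //=.
  have rH1 := rows_frame F1 rH isT; have [_ m1 _] := input_frame F1 inp isT isT.
  have g1 := nmem_frame F1 g9 isT; have h1 := nmem_frame F1 h10 isT.
  have [_ fr _] := F1; have kM : (m + k < M)%N by rewrite /M; lia.
  rewrite /terms mkseqS rev_rcons -/(terms _ _) -p1 k1 m1 g1 h1.
  by rewrite !rH1 // !fr // c3 c4 r5 r6.
- by rewrite /= /L; lia.
Qed.

Lemma runs_emit O fl st : input_intact s st -> rows_are s H st -> logged O st ->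
  nmem st 9%N 0%N = g -> nmem st 10%N 0%N = h -> (g < L)%N -> (h < L)%N ->
  rmem st 3%N 0%N 0%N = c.1 -> rmem st 4%N 0%N 0%N = c.2 -> nmem st 11%N 0%N = fl ->
  rmem st 5%N 0%N 0%N = \sum_(j < n) `|a j| ->
  (fl = 0%N -> forall x, Fmin (conv_hull [set x : 'rV[R]_n | x \in s]) x ->
     0 <= gdot n (homog x) a) ->
  runs emit st (200 * L) (fun st' => exists e, [/\ logged (e ++ O) st', (size e <= 1)%N &
    fl = 0%N -> 0 < \sum_(j < n) `|a j| -> forall x, gdot n (homog x) a < 0 -> cuts e x]).
Proof.
move=> inp rH lg g9 h10 gL hL c3 c4 f11 r5 va.
have [o1 p1 r6 n17 law] := lg.
apply: (runs_if (T1 := 150 * L)); last by rewrite /= /L; lia.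
- rewrite /= f11 r5 leqn0 -ltNge => /andP[/eqP fl0 n0].
  apply: (runs_seq (T1 := 14) (T2 := 136 * L)); last by rewrite /L; lia.
  apply: runs_straight => //; set st1 := straight _ _ => F.
  have inp1 := input_frame F inp isT isT; have rH1 := rows_frame F rH isT.
  have g1 := nmem_frame F g9 isT; have h1 := nmem_frame F h10 isT.
  have [_ fr _] := F; set q := (size O).+1.
  have q1 : rmem st1 6%N 0%N 0%N = q%:R by rewrite /st1 /= /rupd /= r6 -natr1.
  have q2 : nmem st1 17%N 0%N = q by rewrite /st1 /= /nupd /= n17 addn1.
  have r51 : rmem st1 5%N 0%N 0%N = \sum_(j < n) `|a j| by rewrite fr.
  apply: (runs_seq (T1 := 100 * L) (T2 := 36)); last by rewrite /L; lia.
  apply: runs_weaken (runs_emit_terms inp1 rH1 g1 h1 gL hL _ _ r51 q1 p1) _ => //; rewrite ?fr //.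
  move=> st2 F2 [o2 p2] _; apply: runs_straight => //.
  set nrm := \sum_(j < n) _ in n0 p2 *.
  pose con : sparse_con R := (terms (fun j => a j * q%:R / nrm) n, false, a n * q%:R / nrm).
  have q0 : 0 < q%:R / nrm by rewrite divr_gt0 // ltr0n.
  have satE x : satisfies x (decode n con) = (0 <= gdot n (homog x) a).
    rewrite gdot_homog subr_ge0 /satisfies /= -mulrA -(ler_pM2r q0) mulr_suml.
    congr (_ <= _); apply: eq_bigr => j _; rewrite mxE terms_sum //.
    by rewrite -!mulrA [_ * (_ / _)]mulrC !mulrA.
  have [n2 m2 _] := input_frame F2 inp1 isT isT.
  have g2 := nmem_frame F2 g1 isT; have h2 := nmem_frame F2 h1 isT; have [_ fr2 _] := F2.
  exists [:: con]; split => //; last by move=> _ _ x neg; rewrite /cuts has_seq1 satE -ltNge.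
  split => //=.
  + rewrite p2 o2 o1 n2 m2 g2 h2 !fr2 // q1 r51 !fr // c3 c4.
    by rewrite !rH ?/M ?ltn_add2l.
  + by rewrite fr2.
  + exact: nmem_frame F2 q2 isT.
  + split => //; split; [exact: terms_well_indexed | left | by move=> x xF; rewrite satE va].
    rewrite /= (eq_bigr (fun j : 'I_n => `|a j| * (q%:R / nrm))).
      by rewrite -mulr_suml mulrCA divff ?mulr1 // gt_eqF.
    by move=> j _; rewrite mxE terms_sum // -mulrA normrM [X in _ * X]gtr0_norm.
- move=> cond; apply: runs_straight => //.
  exists [::]; split => // fl0 n0; move: cond.
  by rewrite /= f11 r5 fl0 /= -ltNge n0.
Qed.
End Emit.
End Log.

(** * The constraints for one sequence and one coordinate *)

Definition swap_plane : cmd :=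
  Seq (NSet 21 (NVar 9)) (Seq (NSet 9 (NVar 10)) (NSet 10 (NVar 21))).

Definition facets : cmd :=
  Seq load_rows (Seq eliminate_all (Seq find_plane
    (Seq orientation (Seq swap_plane orientation)))).

Section Facets.
Variables (R : realType) (n : nat) (s : seq 'rV[R]_n).
Let m := size s.
Let L := n.+1.
Let M := (m + n.+1)%N.
Implicit Types (st : state R) (O : seq (sparse_con R)).

Lemma last_two_lt (P : pred nat) :
  ((last_two n P).1 < L)%N /\ ((last_two n P).2 < L)%N.
Proof.
rewrite /last_two; have : all (fun b => b < L)%N (iota 0 n.+1).
  by apply/allP => b; rewrite mem_iota.
have : (0 < L)%N by []; move: (iota 0 n.+1) => l.
elim/last_ind: l => [//|l b IH] L0; rewrite all_rcons foldl_rcons => /andP[bL aL].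
by have [h1 h2] := IH L0 aL; case: ifP.
Qed.

(** Only the flag and the column identity are used, so constraints written for dependent rows are
    valid as well. *)
Lemma wrap_gvalid us g h i : (i < n)%N -> (g < L)%N -> (h < L)%N ->
  let H := foldl (elim_row n) (gen s) us in
  let w := gift_wrap (H^~ g) (H^~ h) (gens s i) in
  w.2 = 0%N -> gvalid s i (normal m H g h w.1).
Proof.
move=> ni gL hL H w w2 k gk; have := wrap_flag_valid w2; rewrite -/w => -[E val].
rewrite gdot_normal // -/H -/(gift_wrap _ _ _) -/w E; apply: val.
by rewrite mem_filter mem_iota andbC.
Qed.

(** With zero coefficients the constraint has the same value at all points, including those of S,
    where it is valid. *)
Lemma normal_norm_gt0 (i : nat) (a : nat -> R) (x : 'rV[R]_n) : (0 < m)%N -> (i < n)%N ->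
  gvalid s i a -> gdot n (homog x) a < 0 -> 0 < \sum_(j < n) `|a j|.
Proof.
move=> m0 ni va neg; rewrite lt_neqAle sumr_ge0 // andbT; apply: contraTN neg => /eqP z.
have a0 (j : 'I_n) : a j = 0.
  by apply/normr0_eq0/(psumr_eq0P _ (esym z)).
have E (y : 'rV[R]_n) : gdot n (homog y) a = a n.
  by rewrite gdot_homog big1 ?subr0 // => j _; rewrite a0 mul0r.
rewrite -leNgt E -(E (nth 0 s 0)) -gen_point //; apply: va.
by rewrite /is_gen; move: m0; rewrite /m; lia.
Qed.

Lemma runs_orientation us g h i O st : (0 < m)%N -> (i < n)%N ->
  let H := foldl (elim_row n) (gen s) us in
  input_intact s st -> rows_are s H st -> logged s O st ->
  nmem st 9%N 0%N = g -> nmem st 10%N 0%N = h -> nmem st 6%N 0%N = i ->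
  (g < L)%N -> (h < L)%N ->
  runs orientation st (1100 * M) (fun st' => exists e,
    [/\ logged s (e ++ O) st', (size e <= 1)%N &
    forall x : 'rV[R]_n, let w := gift_wrap (H^~ g) (H^~ h) (gens s i) in
      w.2 = 0%N -> gdot n (homog x) (normal m H g h w.1) < 0 -> cuts e x]).
Proof.
move=> m0 ni H inp rH lg g9 h10 i6 gL hL.
set w := gift_wrap _ _ _.
apply: (runs_seq (T1 := 700 * M) (T2 := 400 * M)); last by rewrite /M; lia.
apply: runs_weaken (runs_wrap_plane inp rH g9 h10 i6 gL hL) _ => // st1 _ E F.
have inp1 := input_frame F inp isT isT; have rH1 := rows_frame F rH isT.
have g1 := nmem_frame F g9 isT; have h1 := nmem_frame F h10 isT.
have lg1 := logged_frame F lg isT.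
have c3 : rmem st1 3%N 0%N 0%N = w.1.1 by rewrite /w -E.
have c4 : rmem st1 4%N 0%N 0%N = w.1.2 by rewrite /w -E.
have fl : nmem st1 11%N 0%N = w.2 by rewrite /w -E.
apply: (runs_seq (T1 := 150 * L) (T2 := 200 * L)); last by rewrite /L /M; lia.
apply: runs_weaken (runs_normal_norm inp1 rH1 g1 h1 gL hL c3 c4) _ => // st2 _ r5 F2.
have inp2 := input_frame F2 inp1 isT isT; have rH2 := rows_frame F2 rH1 isT.
have g2 := nmem_frame F2 g1 isT; have h2 := nmem_frame F2 h1 isT.
have lg2 := logged_frame F2 lg1 isT; have [_ fr _] := F2.
have w2v : w.2 = 0%N -> gvalid s i (normal m H g h w.1) by apply: wrap_gvalid.
apply: runs_weaken (runs_emit inp2 rH2 lg2 g2 h2 gL hL _ _ (nmem_frame F2 fl isT) r5 _) _ => //.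
- by rewrite fr.
- by rewrite fr.
- by move=> /w2v va x xF; apply: (gvalid_sound (i := Ordinal ni)) va xF.
move=> st' _ [e [le se ce]]; exists e; split => // x w' w0 neg; apply: ce => //.
exact: normal_norm_gt0 m0 ni (w2v w0) neg.
Qed.

Lemma runs_facets (d : nat -> nat) i O st : (0 < m)%N -> (i < n)%N ->
  input_intact s st -> logged s O st ->
  (forall l, (l < n.-1)%N -> nmem st 1%N l = d l /\ (d l < m)%N) ->
  nmem st 6%N 0%N = i ->
  runs facets st (2800 * M * L * L) (fun st' => exists e,
    [/\ logged s (e ++ O) st', (size e <= 2)%N & forall x : 'rV[R]_n,
    let us := mkseq (fun l => bump (m + i) (d l + l)) n.-1 in
    let H := foldl (elim_row n) (gen s) us in
    let: (g, h) := last_two n (fun b => H (m + b)%N b != 0) in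
    (exists2 gh, gh \in [:: (g, h); (h, g)] &
      let w := gift_wrap (H^~ gh.1) (H^~ gh.2) (gens s i) in
      w.2 = 0%N /\ gdot n (homog x) (normal m H gh.1 gh.2 w.1) < 0) -> cuts e x]).
Proof.
move=> m0 ni inp lg dd i6; have n0 : (0 < n)%N by exact: leq_ltn_trans ni.
apply: (runs_seq (T1 := 100 * M * L) (T2 := 2700 * M * L * L)); last by rewrite /M /L; nia.
apply: runs_weaken (runs_load_rows inp) _ => // st1 _ r1 F1.
have inp1 := input_frame F1 inp isT isT; have lg1 := logged_frame F1 lg isT.
have i1 := nmem_frame F1 i6 isT.
have dd1 l : (l < n.-1)%N -> nmem st1 1%N l = d l /\ (d l < m)%N.
  by move=> /dd[dl dm]; split => //; exact: nmem_frame F1 dl isT.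
apply: (runs_seq (T1 := 300 * M * L * L) (T2 := 2400 * M * L)); last by rewrite /M /L; nia.
apply: runs_weaken (runs_eliminate_all inp1 r1 dd1 i1 n0) _ => // st2 _.
set us := mkseq _ _; set H := foldl _ _ _ => r2 F2.
have inp2 := input_frame F2 inp1 isT isT; have lg2 := logged_frame F2 lg1 isT.
have i2 := nmem_frame F2 i1 isT.
apply: (runs_seq (T1 := 100 * L) (T2 := 2300 * M)); last by rewrite /M /L; nia.
apply: runs_weaken (runs_find_plane inp2 r2) _ => // st3 _ + F3.
have inp3 := input_frame F3 inp2 isT isT; have lg3 := logged_frame F3 lg2 isT.
have i3 := nmem_frame F3 i2 isT; have r3 := rows_frame F3 r2 isT.
have := last_two_lt (fun b => H (m + b)%N b != 0).
cbv zeta; case: (last_two n _) => g h /= [gL hL] [g3 h3].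
apply: (runs_seq (T1 := 1100 * M) (T2 := 1200 * M)); last by rewrite /M /L; nia.
apply: runs_weaken (runs_orientation m0 ni inp3 r3 lg3 g3 h3 i3 gL hL) _ => //.
move=> st4 _ [e1 [lg4 se1 ce1]] F4.
have inp4 := input_frame F4 inp3 isT isT; have r4 := rows_frame F4 r3 isT.
have i4 := nmem_frame F4 i3 isT; have g4 := nmem_frame F4 g3 isT.
have h4 := nmem_frame F4 h3 isT.
apply: (runs_seq (T1 := 20) (T2 := 1100 * M)); last by rewrite /M /L; nia.
apply: runs_straight => //; set st5 := straight _ _ => F5.
have inp5 := input_frame F5 inp4 isT isT; have r5 := rows_frame F5 r4 isT.
have i5 := nmem_frame F5 i4 isT; have lg5 := logged_frame F5 lg4 isT.
have g5 : nmem st5 9%N 0%N = h by rewrite /st5 /= /nupd.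
have h5 : nmem st5 10%N 0%N = g by rewrite /st5 /= /nupd.
apply: runs_weaken (runs_orientation m0 ni inp5 r5 lg5 g5 h5 i5 hL gL) _ => //.
move=> st6 _ [e2 [lg6 se2 ce2]]; exists (e2 ++ e1); rewrite -catA size_cat; split => //.
  by rewrite (leq_add se2 se1).
have catE (x : 'rV[R]_n) : cuts (e2 ++ e1) x = cuts e2 x || cuts e1 x by exact: has_cat.
move=> x [gh + [w0 neg]]; rewrite !inE catE => /orP[]/eqP E.
  by rewrite (ce1 x) ?orbT //; move: w0 neg; rewrite E.
by rewrite (ce2 x) //; move: w0 neg; rewrite E.
Qed.
End Facets.

(** * The loop over all digit sequences *)

Definition check_sorted : cmd :=
  Seq (Seq (NSet 14 (NConst 1)) (NSet 15 (NConst 0)))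
    (For 3 (NSub dim (NConst 1))
      (Seq (If (BLeN (NVar 15) (NLoad 1 (NVar 3))) Skip (NSet 14 (NConst 0)))
        (NSet 15 (NLoad 1 (NVar 3))))).

Definition increment : cmd :=
  Seq (NSet 16 (NConst 1))
    (For 3 (NSub dim (NConst 1))
      (If (BLeN (NConst 1) (NVar 16))
        (If (BLeN npts (NAdd (NLoad 1 (NVar 3)) (NConst 1)))
          (NStore 1 (NVar 3) (NConst 0))
          (Seq (NStore 1 (NVar 3) (NAdd (NLoad 1 (NVar 3)) (NConst 1)))
            (NSet 16 (NConst 0))))
        Skip)).

Definition pad : cmd :=
  Seq (NSet 21 (NSub (NVar 18) (NVar 17)))
    (For 13 (NVar 21) (Seq count_constraint (Close false (RVar 6)))).

(** Cell 18 is a cumulative target, raised by n m for every t, sorted or not, so the total is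
    independent of how many facets are found. *)
Definition facets_of_digits : cmd :=
  Seq (NSet 18 (NAdd (NVar 18) (NVar 22)))
    (Seq check_sorted
      (Seq (If (BLeN (NConst 1) (NVar 14)) (For 6 dim facets) Skip)
        (Seq pad increment))).

(** Integers can only be added and subtracted, so products and powers are computed by repeated
    addition, within O(n m) time. *)
Definition compute_product : cmd := For 3 dim (NSet 22 (NAdd (NVar 22) npts)).

Definition compute_power : cmd :=
  Seq (NSet 19 (NConst 1))
    (For 3 (NSub dim (NConst 1))
      (Seq (NSet 20 (NConst 0))
        (Seq (For 4 npts (NSet 20 (NAdd (NVar 20) (NVar 19))))
          (NSet 19 (NVar 20))))).

Definition point_equations : cmd :=
  For 3 dim (Seq count_constraint
    (Seq (Term (NVar 3) (RVar 6))
      (Close true (RMul (RVar 6) (RLoad 0 (NConst 0) (NVar 3)))))).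

Definition all_facets : cmd :=
  If (BLeN npts (NConst 1)) point_equations
    (Seq compute_product (Seq compute_power (For 2 (NVar 19) facets_of_digits))).

Section DigitSucc.
Local Open Scope nat_scope.

Lemma dvdn_succ_mod m q : 0 < m -> (m %| q.+1) = (m <= (q %% m).+1).
Proof.
move=> m0; rewrite -[q.+1]addn1 /dvdn -modnDml addn1.
have := ltn_pmod q m0; rewrite leq_eqVlt => /predU1P[->|lt].
  by rewrite modnn leqnn.
by rewrite modn_small // leqNgt lt.
Qed.

(** [m ^ k %| t.+1] says that the k lowest digits of t all equal m - 1, that is, that the carry of
    the increment reaches digit k. *)
Lemma expn_dvd_succ m t k : 0 < m ->
  (m ^ k.+1 %| t.+1) = (m ^ k %| t.+1) && (m <= digit m t k + 1).
Proof.
move=> m0; have mk : 0 < m ^ k by rewrite expn_gt0 m0.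
case: (boolP (m ^ k %| t.+1)) => [dk|ndk] /=; last first.
  by apply/negP => h; case/negP: ndk; apply: dvdn_trans h; rewrite expnS dvdn_mull.
have E : t.+1 = m ^ k * (t %/ m ^ k).+1.
  by rewrite -{1}(divnK dk) divnS // dk add1n mulnC.
by rewrite {1}E expnSr dvdn_pmul2l // dvdn_succ_mod // addn1.
Qed.

Lemma digit_succ m t k : 0 < m -> digit m t.+1 k =
  if m ^ k %| t.+1 then if m <= digit m t k + 1 then 0 else digit m t k + 1
  else digit m t k.
Proof.
move=> m0; have mk : 0 < m ^ k by rewrite expn_gt0 m0.
rewrite {1}/digit divnS //; case: ifP => _; last by rewrite add0n.
by rewrite add1n modnS dvdn_succ_mod // addn1; case: ifP.
Qed.
End DigitSucc.

Section Loop.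
Variables (R : realType) (n : nat) (s : seq 'rV[R]_n).
Let m := size s.
Let L := n.+1.
Let M := (m + n.+1)%N.
Implicit Types (st : state R) (O : seq (sparse_con R)).
Hypothesis n0 : (0 < n)%N.

Definition digits_are t st : Prop :=
  forall l, (l < n.-1)%N -> nmem st 1%N l = digit m t l.

Lemma digits_frame p t st st' : frame p st st' -> digits_are t st ->
  1%N \notin nat_writes p -> digits_are t st'.
Proof. by move=> [fn _ _] h hn l ln; rewrite fn // h. Qed.

Lemma runs_check_sorted t st : input_intact s st -> digits_are t st ->
  runs check_sorted st (80 * n) (fun st' => nmem st' 14%N 0%N = digits_sorted m n.-1 t).
Proof.
move=> inp dt; apply: (runs_seq (T1 := 6) (T2 := 74 * n)); last by lia.
apply: runs_straight => // F; have inp1 := input_frame F inp isT isT.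
have dt1 := digits_frame F dt isT.
apply: (runs_for_const (N := n.-1) (T := 30) (I := fun k st' =>
  nmem st' 14%N 0%N = path leq 0 (mkseq (digit m t) k) /\
  nmem st' 15%N 0%N = last 0%N (mkseq (digit m t) k))) => //.
- by move=> st' F1; have [/= -> _ _] := input_frame F1 inp1 isT isT; rewrite subn1.
- move=> k st2 kn k2 F2 [p2 l2]; apply: runs_straight => //.
  have dt2 := digits_frame F2 dt1 isT.
  rewrite mkseqS rcons_path last_rcons /= k2 l2 dt2 //.
  by case: ifP => _ /=; rewrite /nupd /= k2 dt2 // ?p2 ?andbT ?andbF.
- by rewrite /=; lia.
- by move=> st' _ [].
Qed.

Lemma runs_increment t st : (0 < m)%N -> input_intact s st -> digits_are t st ->
  runs increment st (100 * n) (digits_are t.+1).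
Proof.
move=> m0 inp dt; apply: (runs_seq (T1 := 3) (T2 := 97 * n)); last by lia.
apply: runs_straight => // F; have inp1 := input_frame F inp isT isT.
have dt1 := digits_frame F dt isT.
apply: (runs_for_const (N := n.-1) (T := 50) (I := fun k st' =>
  (forall l, (l < n.-1)%N -> nmem st' 1%N l = digit m (if (l < k)%N then t.+1 else t) l) /\
  nmem st' 16%N 0%N = (m ^ k %| t.+1)%N)) => //.
- by move=> st' F1; have [/= -> _ _] := input_frame F1 inp1 isT isT; rewrite subn1.
- by split => //=; rewrite expn0 dvd1n.
- move=> k st2 kn k2 F2 [d2 c2]; apply: runs_straight => //.
  have [_ m2 _] := input_frame F2 inp1 isT isT.
  have dk : nmem st2 1%N k = digit m t k by rewrite d2 // ltnn.
  have dS l : (l < n.-1)%N -> digit m (if (l < k.+1)%N then t.+1 else t) l =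
      if l == k then digit m t.+1 k else nmem st2 1%N l.
    move=> ln; case: (l =P k) => [->|lk]; rewrite ?leqnn // d2 //.
    by have -> : (l < k.+1)%N = (l < k)%N by lia.
  rewrite expn_dvd_succ //; split=> [l ln|].
    rewrite dS // digit_succ // /= k2 m2 c2 dk.
    case: (m ^ k %| t.+1)%N => /=; last by case: eqP => [->|].
    by case: ifP => _; rewrite /= /nupd /= ?k2 ?dk //; case: eqP.
  rewrite /= k2 m2 c2 dk; case: (m ^ k %| t.+1)%N c2 => c2 //=.
  by case: ifP => _ /=; rewrite /nupd /= ?c2.
- by rewrite /=; lia.
- by move=> st' _ [d _] l ln; rewrite d // ln.
Qed.

Lemma runs_pad O tg st : logged s O st -> nmem st 18%N 0%N = tg -> (size O <= tg)%N ->
  runs pad st (40 * (tg - size O).+1) (fun st' => exists e, logged s (e ++ O) st' /\ size (e ++ O) = tg).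
Proof.
move=> lg t18 Otg; have [_ _ _ n17 _] := lg.
apply: (runs_seq (T1 := 7) (T2 := 40 * (tg - size O) + 33)); last by lia.
apply: runs_straight => //; set st1 := straight _ _ => F.
have lg1 := logged_frame F lg isT.
have d21 : nmem st1 21%N 0%N = (tg - size O)%N by rewrite /st1 /= /nupd /= t18 n17.
apply: (runs_for_const (N := (tg - size O)%N) (T := 20) (I := fun k st' =>
  exists e, logged s (e ++ O) st' /\ size e = k)) => //.
- by move=> st' F1; exact: nmem_frame F1 d21 isT.
- by exists [::].
- move=> k st2 kt k2 F2 [e [[o2 p2 r2 n2 l2] sz]]; apply: runs_straight => //.
  exists (([::], false, (size (e ++ O)).+1%:R) :: e); split; last by rewrite /= sz.
  split => //=; rewrite ?p2 ?o2 /rupd /nupd /= ?r2 ?n2 ?natr1 ?addn1 //.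
  split => //; split => //.
    by right; split => //=; rewrite big1 // => j _; rewrite mxE big_nil normr0.
  move=> x _; rewrite /satisfies /= big1 ?ler0n // => j _.
  by rewrite mxE big_nil mul0r.
- by rewrite /=; lia.
- by move=> st' _ [e [l1 sz]]; exists e; split => //; rewrite size_cat sz; lia.
Qed.

Definition covered t i O : Prop := forall x : 'rV[R]_n,
  let us := mkseq (fun l => bump (m + i) (digit m t l + l)) n.-1 in
  let H := foldl (elim_row n) (gen s) us in
  let: (g, h) := last_two n (fun b => H (m + b)%N b != 0) in
  (exists2 gh, gh \in [:: (g, h); (h, g)] &
    let w := gift_wrap (H^~ gh.1) (H^~ gh.2) (gens s i) in
    w.2 = 0%N /\ gdot n (homog x) (normal m H gh.1 gh.2 w.1) < 0) -> cuts O x.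

Lemma cuts_cat O e (x : 'rV[R]_n) : cuts (e ++ O) x = cuts e x || cuts O x.
Proof. exact: has_cat. Qed.

Lemma covered_cat t i O e : covered t i O -> covered t i (e ++ O).
Proof.
move=> c x; have := c x; cbv zeta; case: (last_two n _) => g h h1 h2.
by rewrite cuts_cat h1 ?orbT.
Qed.

Definition facet_time : nat := n * (2800 * M * L * L + 12) + 9.

Lemma runs_facet_loop t O st : (0 < m)%N -> input_intact s st -> digits_are t st ->
  logged s O st -> runs (For 6 dim facets) st facet_time (fun st' => exists e,
    [/\ logged s (e ++ O) st', (size e <= 2 * n)%N &
      forall i, (i < n)%N -> covered t i (e ++ O)]).
Proof.
move=> m0 inp dt lg.
apply: (runs_for_const (N := n) (T := (2800 * M * L * L)%N) (I := fun k st' => exists e,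
    [/\ logged s (e ++ O) st', (size e <= 2 * k)%N &
      forall i, (i < k)%N -> covered t i (e ++ O)])) => //.
- by move=> st' F1; have [/= -> _ _] := input_frame F1 inp isT isT.
- by exists [::].
- move=> k st1 kn k1 F1 [e [lg1 se ce]].
  have inp1 := input_frame F1 inp isT isT; have dt1 := digits_frame F1 dt isT.
  apply: runs_weaken (runs_facets (d := digit m t) m0 kn inp1 lg1 _ k1) _ => //.
    by move=> l ln; split; [exact: dt1 | exact: digit_lt].
  move=> st2 _ [e' [lg2 se' ce']]; exists (e' ++ e); rewrite -catA size_cat; split => //.
    by lia.
  move=> i; rewrite ltnS leq_eqVlt => /predU1P[->|ik]; last exact: covered_cat (ce i ik).
  move=> x; have := ce' x; cbv zeta; case: (last_two n _) => g h h1 h2.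
  by rewrite cuts_cat h1.
Qed.

Definition progress t st : Prop := [/\ digits_are t st,
  nmem st 22%N 0%N = (n * m)%N, nmem st 18%N 0%N = (t * (n * m))%N & exists O,
  [/\ logged s O st, size O = (t * (n * m))%N & forall t', (t' < t)%N ->
    digits_sorted m n.-1 t' -> forall i, (i < n)%N -> covered t' i O]].

Lemma runs_facets_of_digits t st : (1 < m)%N -> input_intact s st -> progress t st ->
  runs facets_of_digits st (400 * (n * m) + digits_sorted m n.-1 t * facet_time)
    (progress t.+1).
Proof.
move=> m1 inp [dt nm tg [O [lg sO cO]]]; have m0 := ltnW m1.
set F0 := (digits_sorted _ _ _ * _)%N.
apply: (runs_seq (T1 := 7) (T2 := 393 * (n * m) + F0)); last by nia.
apply: runs_straight => //; set st1 := straight _ _ => F1.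
have inp1 := input_frame F1 inp isT isT; have dt1 := digits_frame F1 dt isT.
have lg1 := logged_frame F1 lg isT; have nm1 := nmem_frame F1 nm isT.
have tg1 : nmem st1 18%N 0%N = (t.+1 * (n * m))%N.
  by rewrite /st1 /= /nupd /= tg nm mulSn addnC.
apply: (runs_seq (T1 := 80 * n) (T2 := 310 * (n * m) + F0)); last by nia.
apply: runs_weaken (runs_check_sorted inp1 dt1) _ => // st2 _ ok2 F2.
have inp2 := input_frame F2 inp1 isT isT; have dt2 := digits_frame F2 dt1 isT.
have lg2 := logged_frame F2 lg1 isT; have nm2 := nmem_frame F2 nm1 isT.
have tg2 := nmem_frame F2 tg1 isT.
apply: (runs_seq (T1 := 5 + F0) (T2 := 300 * (n * m))); last by nia.
have step : runs (If (BLeN (NConst 1) (NVar 14)) (For 6 dim facets) Skip) st2 (5 + F0)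
    (fun st' => exists e, [/\ logged s (e ++ O) st', (size e <= 2 * n)%N &
      digits_sorted m n.-1 t -> forall i, (i < n)%N -> covered t i (e ++ O)]).
  rewrite /F0; case: (digits_sorted m n.-1 t) ok2 => ok2.
    apply: (runs_if (T1 := facet_time)) => /=; rewrite ?ok2 //; last by lia.
    move=> _; apply: runs_weaken (runs_facet_loop m0 inp2 dt2 lg2) _ => //.
    by move=> st' _ [e [l1 s1 c1]]; exists e.
  apply: (runs_if (T1 := 1)) => /=; rewrite ?ok2 //.
  by move=> _; apply: runs_straight => //; exists [::].
apply: runs_weaken step _ => // st3 _ [e [lg3 se ce]] F3.
have inp3 := input_frame F3 inp2 isT isT; have dt3 := digits_frame F3 dt2 isT.
have nm3 := nmem_frame F3 nm2 isT; have tg3 := nmem_frame F3 tg2 isT.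
(* The at most 2n facets fit into n m places because there are at least two points. *)
have seO : (size (e ++ O) <= t.+1 * (n * m))%N.
  rewrite size_cat sO mulSn leq_add2r; apply: leq_trans se _.
  by rewrite mulnC leq_mul2l m1 orbT.
apply: (runs_seq (T1 := 40 * (n * m).+1) (T2 := 100 * n)); last by nia.
have padT : (40 * (t.+1 * (n * m) - size (e ++ O)).+1 <= 40 * (n * m).+1)%N.
  by rewrite leq_mul2l ltnS leq_subLR size_cat sO mulSn; lia.
apply: runs_weaken padT (runs_pad lg3 tg3 seO) _ => st4 F4 [e' [lg4 sz4]] _.
have inp4 := input_frame F4 inp3 isT isT; have dt4 := digits_frame F4 dt3 isT.
have nm4 := nmem_frame F4 nm3 isT; have tg4 := nmem_frame F4 tg3 isT.
apply: runs_weaken (runs_increment m0 inp4 dt4) _ => // st5 F5 dt5; split => //.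
- exact: nmem_frame F5 nm4 isT.
- exact: nmem_frame F5 tg4 isT.
exists (e' ++ e ++ O); split => //; first exact: logged_frame F5 lg4 isT.
move=> t'; rewrite ltnS leq_eqVlt => /predU1P[->|tt] st' i ni.
  by apply: covered_cat; apply: ce.
by do 2 apply: covered_cat; apply: cO tt st' i ni.
Qed.

Lemma runs_compute_product st : input_intact s st -> nmem st 22%N 0%N = 0%N ->
  runs compute_product st (40 * n) (fun st' => nmem st' 22%N 0%N = (n * m)%N).
Proof.
move=> inp z; apply: (runs_for_const (N := n) (T := 10) (I := fun k st' =>
  nmem st' 22%N 0%N = (k * m)%N)) => //.
- by move=> st' F1; have [/= -> _ _] := input_frame F1 inp isT isT.
- move=> k st1 kn k1 F1 p1; apply: runs_straight => //.
  have [_ m1 _] := input_frame F1 inp isT isT.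
  by rewrite /= /nupd /= p1 m1 mulSn addnC.
- by rewrite /=; lia.
Qed.

Lemma runs_compute_power st : (0 < m)%N -> input_intact s st ->
  runs compute_power st (100 * (n * m)) (fun st' => nmem st' 19%N 0%N = (m ^ n.-1)%N).
Proof.
move=> m0 inp; apply: (runs_seq (T1 := 3) (T2 := 97 * (n * m))); last by nia.
apply: runs_straight => // F; have inp1 := input_frame F inp isT isT.
apply: (runs_for_const (N := n.-1) (T := (60 * m)%N) (I := fun k st' =>
  nmem st' 19%N 0%N = (m ^ k)%N)) => //.
- by move=> st' F1; have [/= -> _ _] := input_frame F1 inp1 isT isT; rewrite subn1.
- move=> k st1 kn k1 F1 p1; have inp2 := input_frame F1 inp1 isT isT.
  apply: (runs_seq (T1 := 3) (T2 := 57 * m)); last by lia.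
  apply: runs_straight => // F2; have inp3 := input_frame F2 inp2 isT isT.
  have p2 := nmem_frame F2 p1 isT.
  apply: (runs_seq (T1 := 40 * m) (T2 := 4)); last by lia.
  apply: (runs_for_const (N := m) (T := 10) (I := fun k' st' =>
    nmem st' 20%N 0%N = (k' * m ^ k)%N)) => //.
  + by move=> st' F3; have [_ /= -> _] := input_frame F3 inp3 isT isT.
  + move=> k' st' _ _ F3 p3; apply: runs_straight => //.
    by rewrite /= /nupd /= p3 (nmem_frame F3 p2 isT) mulSn addnC.
  + by rewrite /=; lia.
  + by move=> st' _ p3 _; apply: runs_straight => //; rewrite /= /nupd /= p3 expnS.
- by rewrite /=; nia.
Qed.

Lemma runs_point_equations a st : s = [:: a] -> input_intact s st -> logged s [::] st ->
  runs point_equations st (60 * n) (fun st' => exists O, [/\ logged s O st', size O = n &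
    forall x : 'rV[R]_n, ~~ cuts O x -> x = a]).
Proof.
move=> sa inp lg; apply: (runs_for_const (N := n) (T := 35) (I := fun k st' => exists O,
  [/\ logged s O st', size O = k & forall x : 'rV[R]_n, ~~ cuts O x ->
    forall i : 'I_n, (i < k)%N -> x 0 i = a 0 i])) => //.
- by move=> st' F1; have [/= -> _ _] := input_frame F1 inp isT isT.
- by exists [::].
- move=> k st1 kn k1 F1 [O [[o2 p2 r2 n2 l2] sz cO]]; apply: runs_straight => //.
  have [_ _ i1] := input_frame F1 inp isT isT.
  pose i := Ordinal kn; have ai : coord (nth 0 s 0) k = a 0 i by rewrite sa (coordE _ i).
  pose q : R := (size O).+1%:R; have q0 : 0 < q by rewrite ltr0n.
  pose con : sparse_con R := ([:: (k, q)], true, q * a 0 i).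
  have de : (decode n con).1.1 = \row_j (if j == i then q else 0).
    apply/rowP => j; rewrite !mxE /= big_cons big_nil addr0 eq_sym.
    by rewrite -(inj_eq val_inj).
  have satE x : satisfies x (decode n con) = (x 0 i == a 0 i).
    have -> : satisfies x (decode n con) =
        (\sum_j (decode n con).1.1 0 j * x 0 j == q * a 0 i) by [].
    rewrite de (bigD1 i) //= mxE eqxx big1 ?addr0.
      by rewrite (inj_eq (mulfI _)) // gt_eqF.
    by move=> j ji; rewrite mxE (negPf ji) mul0r.
  have l1 : \sum_j `|(decode n con).1.1 0 j| = q.
    rewrite de (bigD1 i) //= mxE eqxx big1 ?addr0 ?gtr0_norm //.
    by move=> j ji; rewrite mxE (negPf ji) normr0.
  exists (con :: O); split.
  + split => //=; rewrite /rupd /nupd /= ?p2 ?o2 ?r2 ?n2 ?natr1 ?addn1 ?k1 ?i1 ?ai //.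
    split => //; split; first by rewrite /well_indexed /= kn.
      by left; exact: l1.
    move=> x /(Fmin_coord _ _ n0)/(_ i)[p [pX _ pi]]; rewrite satE -pi.
    have le c : c * p 0 i <= c * a 0 i.
      have E (y : 'rV[R]_n) : \sum_(j < n) (if j == i then c else 0) * y 0 j = c * y 0 i.
        rewrite (bigD1 i) //= eqxx big1 ?addr0 // => j /negPf ->.
        by rewrite mul0r.
      rewrite -!E; apply: conv_hull_le pX => y; rewrite /= sa inE => /eqP ->.
      exact: lexx.
    have := le 1; have := le (-1); rewrite !mulN1r !mul1r lerN2 => h1 h2.
    by rewrite eq_le h1 h2.
  + by rewrite /= sz.
  + move=> x; have -> : cuts (con :: O) x = ~~ satisfies x (decode n con) || cuts O x by [].
    rewrite satE negb_or negbK => /andP[/eqP xi cx] j.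
    rewrite ltnS leq_eqVlt => /predU1P[jk|jk]; last exact: cO.
    by have -> : j = i by apply: val_inj.
- by rewrite /=; lia.
- move=> st' _ [O [l sz cO]]; exists O; split => // x cx; apply/rowP => i.
  exact: cO.
Qed.
End Loop.

(** * Total running time and correctness *)

Lemma pow4_bound k : (k.+2 ^ 4 <= 82 * 2 ^ k)%N.
Proof.
(* The quotient is largest at k = 4, where it is 81; from there on the fourth power at most doubles
   at each step. *)
case: k => [//|[//|[//|[//|j]]]]; elim: j => [//|j IH].
rewrite (expnS 2) mulnCA; apply: leq_trans (leq_mul (leqnn 2) IH).
rewrite !expnS expn0; nia.
Qed.

Lemma sum_indicator_affine (N X Y Z : nat) (b : pred nat) :
  (\sum_(0 <= t < N) (X + b t * Z + Y) = N * (X + Y) + count b (iota 0 N) * Z)%N.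
Proof.
rewrite -sum1_count [in RHS]big_mkcond /index_iota subn0 big_distrl /=.
elim: N => [|N IH]; first by rewrite !big_nil.
rewrite iotaSr add0n -!cats1 !big_cat !big_seq1 /= IH.
by case: (b N) => /=; lia.
Qed.

Section Main.
Variables (R : realType) (n : nat) (s : seq 'rV[R]_n).
Let m := size s.
Let L := n.+1.
Let M := (m + n.+1)%N.
Hypotheses (n0 : (0 < n)%N) (m0 : (0 < m)%N) (us : uniq s).

Lemma facet_time_le : (1 < m)%N ->
  (facet_time s <= 2821 * (n * m) * L ^ 3)%N.
Proof.
move=> m1; rewrite /facet_time -/m -/L !expnS expn0 muln1.
have ML : (M <= m * L)%N by rewrite /M /L; nia.
have L1 : (0 < L)%N by [].
have h : (n * (2800 * M * L * L) <= n * (2800 * (m * L) * L * L))%N.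
  by rewrite leq_mul2l !leq_mul ?orbT.
have k : (n * 12 + 9 <= 21 * (n * m * (L * L * L)))%N.
  have : (n <= n * m * (L * L * L))%N by rewrite -mulnA leq_pmulr // !muln_gt0 m0 L1.
  by lia.
by lia.
Qed.

(** With c sorted sequences, c 2^(n-1) <= n m^(n-1) and n L^3 <= L^4 <= 82 2^(n-1) give c L^3 <= 82
    m^(n-1): their rarity pays for the polynomial work on each. *)
Lemma sorted_facet_time : (1 < m)%N ->
  (count (digits_sorted m n.-1) (iota 0 (m ^ n.-1)) * facet_time s <=
    2821 * 82 * (n * m ^ n))%N.
Proof.
move=> m1; set c := count _ _.
have h : (c * L ^ 3 <= 82 * m ^ n.-1)%N.
  rewrite -(leq_pmul2r (expn_gt0 2 n.-1)).
  have := sorted_count_bound n.-1 m1; rewrite -/c => hc.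
  apply: (@leq_trans (n.-1.+1 * m ^ n.-1 * L ^ 3)).
    by rewrite mulnAC leq_mul2r hc orbT.
  apply: (@leq_trans (L ^ 4 * m ^ n.-1)).
    rewrite mulnAC leq_mul2r [(L ^ 4)%N]expnS leq_mul2r prednK // /L leqnSn !orbT //.
  rewrite mulnAC leq_mul2r; apply/orP; right.
  by have := pow4_bound n.-1; rewrite prednK.
apply: leq_trans (leq_mul (leqnn c) (facet_time_le m1)) _.
have -> : (m ^ n = m * m ^ n.-1)%N by rewrite -expnS prednK.
have -> : (c * (2821 * (n * m) * L ^ 3) = 2821 * (n * m) * (c * L ^ 3))%N.
  by rewrite mulnCA.
apply: leq_trans (leq_mul (leqnn _) h) _.
by rewrite -!mulnA leq_mul2l /=; lia.
Qed.

Let F := Fmin (conv_hull [set x : 'rV[R]_n | x \in s]).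

Lemma runs_all_facets : runs all_facets (init_state s) (300 * 1000 * (n * m ^ n))
  (fun st' => exists O, [/\ logged s O st', size O = (n * m ^ n)%N &
    forall x, ~~ cuts O x -> F x]).
Proof.
have inp : input_intact s (init_state s) by split.
have lg : logged s [::] (init_state s) by split.
apply: (runs_if (T1 := 290 * 1000 * (n * m ^ n))).
- rewrite /= -/m => m1; have {m1} m1 : m = 1%N by lia.
  rewrite m1 exp1n muln1.
  have [a sa] : exists a, s = [:: a].
    by have : size s = 1%N := m1; case: (s) => [|a [|b l]] //; exists a.
  apply: runs_weaken (runs_point_equations n0 sa inp lg) _; first by lia.
  move=> st' _ [O [lO sO cO]]; exists O; split => // x /cO ->.
  apply/(Fmin_coord _ _ n0) => i; exists a; split => // Y [_]; apply.
  by rewrite /= sa mem_head.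
- rewrite /= -/m -ltnNge => m1; have mn0 : (0 < m ^ n)%N by rewrite expn_gt0 m0.
  have mE : (m ^ n = m * m ^ n.-1)%N by rewrite -expnS prednK.
  have mn : (m <= m ^ n)%N by rewrite mE leq_pmulr // expn_gt0 m0.
  have nm : (n * m <= n * m ^ n)%N by rewrite leq_mul2l mn orbT.
  apply: (runs_seq (T1 := 40 * n) (T2 := 280 * 1000 * (n * m ^ n))); last first.
    have : (n <= n * m ^ n)%N by rewrite leq_pmulr.
    by lia.
  apply: runs_weaken (runs_compute_product n0 inp (erefl _)) _ => // st1 _ nm1 F1.
  have inp1 := input_frame F1 inp isT isT; have lg1 := logged_frame F1 lg isT.
  have z18 : nmem (init_state s) 18%N 0%N = 0%N by [].
  have z1 l : nmem (init_state s) 1%N l = 0%N by [].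
  have t1 := nmem_frame F1 z18 isT.
  have d1 : digits_are s 0 st1.
    by move=> l ln; rewrite /digit div0n mod0n; exact: nmem_frame F1 (z1 l) isT.
  apply: (runs_seq (T1 := 100 * (n * m)) (T2 := 270 * 1000 * (n * m ^ n))); last by lia.
  apply: runs_weaken (runs_compute_power n0 m0 inp1) _ => // st2 _ pw F2.
  have inp2 := input_frame F2 inp1 isT isT; have lg2 := logged_frame F2 lg1 isT.
  have t2 := nmem_frame F2 t1 isT; have nm2 := nmem_frame F2 nm1 isT.
  have d2 := digits_frame F2 d1 isT.
  apply: (runs_for (N := (m ^ n.-1)%N) (I := progress s)
    (T := fun t => (400 * (n * m) + digits_sorted m n.-1 t * facet_time s)%N)) => //.
  + by move=> st' F3; exact: nmem_frame F3 pw isT.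
  + by split => //; exists [::].
  + move=> t st' _ _ F3 pt; apply: runs_facets_of_digits => //.
    exact: input_frame F3 inp2 isT isT.
  + rewrite sum_indicator_affine.
    have := sorted_facet_time m1; set c := (count _ _ * _)%N => hc.
    have E : (m ^ n.-1 * (400 * (n * m)) = 400 * (n * m ^ n))%N by rewrite mE; lia.
    have E' : (m ^ n.-1 <= n * m ^ n)%N.
      by rewrite mE mulnA leq_pmull // muln_gt0 n0 m0.
    rewrite mulnDr E; have : (0 < n * m ^ n)%N by rewrite muln_gt0 n0.
    rewrite /=; lia.
  + move=> st' _ [_ _ _ [O [lO sO cO]]]; exists O; split => //.
      by rewrite sO mE; lia.
    (* Completeness: a point outside is cut off at some sorted t, whose constraints were written in
       round t. *)
    move=> x; apply: contraNP => nF.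
    have [i [t [ni tm ts h]]] := separating_ridge n0 m1 us nF.
    by move: h (cO t tm ts i ni x); cbv zeta; case: (last_two n _) => g h h1 h2; exact: h2.
- have : (0 < n * m ^ n)%N by rewrite muln_gt0 n0 expn_gt0 m0.
  by rewrite /=; lia.
Qed.
End Main.

Theorem theorem3 (R : realType) :
  exists (p : cmd) (C : nat),
  forall (n m : nat) (S : {fset 'rV[R]_n}) (s : seq 'rV[R]_n),
    (0 < n)%N -> (0 < m)%N -> #|` S| = m -> perm_eq s S ->
  exists (t : nat) (K : {fset lincon R n}),
    [/\ constructs p s t K,
        (t <= C * (n * m ^ n))%N,
        #|` K| = (n * m ^ n)%N
      & solutions K = Fmin (conv_hull [set` S])].
Proof.
exists all_facets, (300 * 1000)%N => n m S s n0 m0 Sm sS.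
have sm : size s = m by rewrite (perm_size sS).
have us : uniq s by rewrite (perm_uniq sS) fset_uniq.
have [|t [st' [E tT [O [lO sO cO]]]]] := runs_all_facets n0 _ us; first by rewrite sm.
rewrite sm in tT sO.
have XS : [set x : 'rV[R]_n | x \in s] = [set` S].
  by apply/seteqP; split => x /=; rewrite (perm_mem sS).
have [oE _ _ _ law] := lO.
(* Distinctness turns the number of written constraints into the cardinality of the set. *)
have uO := lawful_uniq law.
pose K : {fset lincon R n} := [fset c in map (decode n) O]%fset.
have pK : perm_eq (map (decode n) O) K.
  by apply: uniq_perm => // [|c]; [exact: fset_uniq | rewrite in_fset].
exists t, K; split => //.
- exists st'; split; rewrite ?oE //.
  by elim: (O) law => //= c O' IH [[-> _ _] /IH].
- by rewrite -(perm_size pK) size_map.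
rewrite -XS; apply/seteqP; split => x /=.
  move=> h; apply: cO; apply/hasPn => c cO'; rewrite negbK; apply: h.
  by rewrite -(perm_mem pK); exact: map_f.
move=> xF c; rewrite -(perm_mem pK) => /mapP[c' cO' ->].
elim: (O) law cO' => //= c1 O' IH [[_ _ snd] /IH {}IH]; rewrite inE => /predU1P[->|/IH//].
exact: snd.
Qed.
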